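(* Let $(K,v)$ be a henselian valued field of arbitrary rank, let $w$ be an extension of $v$ to $K(X)$, and let $Q$ be an abstract key polynomial (ABKP) for $w$. Then for an ABKP $F\in K[X]$ for $w$ the following are equivalent: (i) $(F,Q)$ is a distinguished pair. (ii) $F$ is a key polynomial for $w_Q$ and $\deg F>\deg Q$.
   Context: Let $\bar v$ be the extension of $v$ to a fixed algebraic closure $\overline K$ of $K$. For $\theta\in\overline K$, $\deg\theta=[K(\theta):K]$. For $f\in K[X]$ and a positive integer $b$, $\partial_b f=\frac{1}{b!}\frac{\partial^b f}{\partial X^b}$ is the $b$-th formal (Hasse) derivative, and $\epsilon(f)=\max_{b\in\mathbb N}\frac{w(f)-w(\partial_b f)}{b}$, where $\mathbb N$ is the set of positive integers (an element of the divisible hull of the value group $\Gamma_w$; terms with $\partial_b f=0$ count as $-\infty$). A monic nonconstant polynomial $Q\in K[X]$ is an abstract key polynomial (ABKP) for $w$ if every $f\in K[X]$ with $\epsilon(f)\ge\epsilon(Q)$ satisfies $\deg f\ge\deg Q$. ABKPs are irreducible over $K$. The $Q$-truncation of $w$ is $w_Q(f)=\min_i\{w(f_iQ^i)\}$, where $f=\sum_i f_iQ^i$, $\deg f_i<\deg Q$, is the $Q$-expansion of $f$; for an ABKP $Q$ it is a valuation on $K(X)$. Key polynomials: for a valuation $u$ on $K(X)$ and $f,g\in K[X]$, write $f\sim_u g$ if $u(f-g)>u(f)=u(g)$; say $f$ $u$-divides $g$ ($f|_u g$) if $g\sim_u fh$ for some $h\in K[X]$; $f$ is $u$-irreducible if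 whenever $f|_u hq$ with $h,q\in K[X]$, then $f|_u h$ or $f|_u q$; $f$ is $u$-minimal if for every $h\in K[X]$ with $f|_u h$ one has $\deg h\ge\deg f$. A key polynomial for $u$ is a monic polynomial that is $u$-irreducible and $u$-minimal. A pair $(\theta,\alpha)$ of elements of $\overline K$ is a $(K,v)$-distinguished pair if: $\deg\theta>\deg\alpha$; $\bar v(\theta-\alpha)=\max\{\bar v(\theta-\beta)\mid\beta\in\overline K,\ \deg\beta<\deg\theta\}$; and $\bar v(\theta-\eta)<\bar v(\theta-\alpha)$ for every $\eta\in\overline K$ with $\deg\eta<\deg\alpha$. For irreducible polynomials $g,f$ over $K$, $(g,f)$ is a distinguished pair if there are a root $\theta$ of $g$ and a root $\alpha$ of $f$ such that $(\theta,\alpha)$ is a $(K,v)$-distinguished pair. *)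

(* Defs.v *)
From HB Require Import structures.
From mathcomp Require Import all_boot all_order all_algebra.
From mathcomp Require Import boolp classical_sets.

Set Implicit Arguments.
Unset Strict Implicit.
Unset Printing Implicit Defensive.

Import Order.TTheory GRing.Theory Num.Theory.

Local Open Scope ring_scope.

(* A divisible totally ordered abelian group is the same thing as a totally
   ordered rational vector space.  All valuations below take values in such a
   group G, with a point oo added, and are not assumed surjective: the value
   group is a subgroup of G.  Since every ordered abelian group embeds in its
   divisible hull, this does not restrict the value groups; it lets valuations
   of K, K(X) and the algebraic closure of K be compared literally, and gives
   a meaning to gamma / b for gamma in a value group and b a positive integer. *)
Record ordQSpace := OrdQSpace {
  ordQ_lmod : lmodType rat;
  ordQ_le : rel ordQ_lmod;
  ordQ_anti : antisymmetric ordQ_le;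
  ordQ_trans : transitive ordQ_le;
  ordQ_total : total ordQ_le;
  ordQ_addl : forall z x y, ordQ_le x y -> ordQ_le (z + x) (z + y)
}.

Definition ordQ_sort (G : ordQSpace) : Type := ordQ_lmod G.
Coercion ordQ_sort : ordQSpace >-> Sortclass.

Section OrdQSpaceInstances.
Variable G : ordQSpace.
HB.instance Definition _ := GRing.Lmodule.copy (ordQ_sort G) (ordQ_lmod G).
Let ordQ_refl : reflexive (@ordQ_le G).
Proof. by move=> x; have := ordQ_total x x; rewrite orbb. Qed.
HB.instance Definition _ := Order.Le_isPOrder.Build ring_display (ordQ_sort G)
  ordQ_refl (@ordQ_anti G) (@ordQ_trans G).
HB.instance Definition _ :=
  Order.POrder_isTotal.Build ring_display (ordQ_sort G) (@ordQ_total G).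
End OrdQSpaceInstances.

Variant withTop (T : Type) := Val of T | Infty.
Arguments Infty {T}.

Section WithTopChoice.
Context {T : choiceType}.
Definition withTop_opt (a : withTop T) : option T :=
  if a is Val x then Some x else None.
Definition opt_withTop (o : option T) : withTop T :=
  if o is Some x then Val x else Infty.
Lemma withTop_optK : cancel withTop_opt opt_withTop. Proof. by case. Qed.
HB.instance Definition _ := Equality.copy (withTop T) (can_type withTop_optK).
HB.instance Definition _ := Choice.copy (withTop T) (can_type withTop_optK).
End WithTopChoice.

Section WithTopOrder.
Context {T : orderType ring_display}.
Implicit Types a b c : withTop T.

Definition le_withTop a b :=
  match a, b with
  | _, Infty => true
  | Val x, Val y => x <= y
  | Infty, Val _ => false
  end.

Lemma le_withTop_refl : reflexive le_withTop. Proof. by case=> //= x. Qed.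
Lemma le_withTop_anti : antisymmetric le_withTop.
Proof. by case=> [x|] [y|] //= /le_anti ->. Qed.
Lemma le_withTop_trans : transitive le_withTop.
Proof. by case=> [y|] [x|] [z|] //=; apply: le_trans. Qed.
Lemma le_withTop_total : total le_withTop.
Proof. by case=> [x|] [y|] //=; apply: le_total. Qed.

HB.instance Definition _ := Order.Le_isPOrder.Build ring_display (withTop T)
  le_withTop_refl le_withTop_anti le_withTop_trans.
HB.instance Definition _ :=
  Order.POrder_isTotal.Build ring_display (withTop T) le_withTop_total.
Lemma le_withTop_top a : a <= Infty. Proof. by case: a. Qed.
HB.instance Definition _ :=
  Order.hasTop.Build ring_display (withTop T) le_withTop_top.
End WithTopOrder.

Section WithTopAdd.
Context {T : nmodType}.
Implicit Types a b c : withTop T.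

Definition add_withTop a b :=
  if a is Val x then if b is Val y then Val (x + y) else Infty else Infty.

Lemma add_withTopA : associative add_withTop.
Proof. by case=> [x|] [y|] [z|] //=; rewrite addrA. Qed.
Lemma add_withTopC : commutative add_withTop.
Proof. by case=> [x|] [y|] //=; rewrite addrC. Qed.
Lemma add_0withTop : left_id (Val 0) add_withTop.
Proof. by case=> [x|] //=; rewrite add0r. Qed.
HB.instance Definition _ := GRing.isNmodule.Build (withTop T)
  add_withTopA add_withTopC add_0withTop.
End WithTopAdd.

Variant withBot (T : Type) := NInfty | BVal of T.
Arguments NInfty {T}.

Section WithBotChoice.
Context {T : choiceType}.
Definition withBot_opt (a : withBot T) : option T :=
  if a is BVal x then Some x else None.
Definition opt_withBot (o : option T) : withBot T :=
  if o is Some x then BVal x else NInfty.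
Lemma withBot_optK : cancel withBot_opt opt_withBot. Proof. by case. Qed.
HB.instance Definition _ := Equality.copy (withBot T) (can_type withBot_optK).
HB.instance Definition _ := Choice.copy (withBot T) (can_type withBot_optK).
End WithBotChoice.

Section WithBotOrder.
Context {T : orderType ring_display}.
Implicit Types a b c : withBot T.

Definition le_withBot a b :=
  match a, b with
  | NInfty, _ => true
  | BVal x, BVal y => x <= y
  | BVal _, NInfty => false
  end.

Lemma le_withBot_refl : reflexive le_withBot. Proof. by case=> //= x. Qed.
Lemma le_withBot_anti : antisymmetric le_withBot.
Proof. by case=> [|x] [|y] //= /le_anti ->. Qed.
Lemma le_withBot_trans : transitive le_withBot.
Proof. by case=> [|y] [|x] [|z] //=; apply: le_trans. Qed.
Lemma le_withBot_total : total le_withBot.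
Proof. by case=> [|x] [|y] //=; apply: le_total. Qed.

HB.instance Definition _ := Order.Le_isPOrder.Build ring_display (withBot T)
  le_withBot_refl le_withBot_anti le_withBot_trans.
HB.instance Definition _ :=
  Order.POrder_isTotal.Build ring_display (withBot T) le_withBot_total.
Lemma le_withBot_bot a : NInfty <= a. Proof. by case: a. Qed.
HB.instance Definition _ :=
  Order.hasBottom.Build ring_display (withBot T) le_withBot_bot.
End WithBotOrder.

Record valuation (G : ordQSpace) (L : fieldType) (u : L -> withTop G) : Prop :=
  Valuation {
    val_eqoo : forall x, u x = Infty <-> x = 0;
    val_mul : forall x y, u (x * y) = u x + u y;
    val_add : forall x y, Order.min (u x) (u y) <= u (x + y)
  }.

Definition extends (G : ordQSpace) (K L : fieldType) (f : K -> L)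
    (v : K -> withTop G) (u : L -> withTop G) : Prop :=
  forall a, u (f a) = v a.

Definition algebraic_closure (K : fieldType) (Kbar : closedFieldType)
    (iota : {rmorphism K -> Kbar}) : Prop :=
  forall x, algebraicOver iota x.

(* Every extension of v to Kbar is equivalent to exactly one with values in the
   divisible group G that restricts to v, so uniqueness up to equivalence is
   equality of functions here.  Existence always holds. *)
Definition henselian (G : ordQSpace) (K : fieldType) (Kbar : closedFieldType)
    (iota : {rmorphism K -> Kbar}) (v : K -> withTop G) : Prop :=
  forall u1 u2 : Kbar -> withTop G,
    valuation u1 -> extends iota v u1 ->
    valuation u2 -> extends iota v u2 -> u1 =1 u2.

Section Degree.
Variables (K L : fieldType) (iota : {rmorphism K -> L}).

(* K(t) *)
Definition adjoin (t : L) : set L :=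
  [set x | exists p q : {poly K}, (map_poly iota q).[t] != 0 /\
             x = (map_poly iota p).[t] / (map_poly iota q).[t]]%classic.

Definition has_dim (S : set L) (n : nat) : Prop :=
  exists e : 'I_n -> L, (forall i, S (e i)) /\
    forall x, S x -> exists! c : 'rV[K]_n, x = \sum_i iota (c 0 i) * e i.

(* [K(t) : K]; the default 0 is only taken when this dimension is infinite *)
Definition degree (t : L) : nat := xget 0%N (has_dim (adjoin t)).
End Degree.

Section Polynomials.
Variables (G : ordQSpace) (K : fieldType).
Implicit Types (w u : {poly K} -> withTop G) (f g h q Q : {poly K}).

(* (w f - w (d_b f)) / b, where f^`N(b) is the Hasse derivative d_b f *)
Definition eps_term w f (b : nat) : withBot G :=
  if (w f, w f^`N(b)) is (Val x, Val y) then BVal ((b%:R : rat)^-1 *: (x - y))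
  else NInfty.

(* d_b f = 0 when b >= size f, so the remaining terms are all -oo *)
Definition eps w f : withBot G :=
  \big[Order.max/Order.bottom]_(1 <= b < size f) eps_term w f b.

(* for polynomials, size = degree + 1 *)
Definition ABKP w Q : Prop :=
  [/\ Q \is monic, (1 < size Q)%N &
      forall f, eps w Q <= eps w f -> (size Q <= size f)%N].

Definition Qcoef Q f (i : nat) : {poly K} := (f %/ Q ^+ i) %% Q.

Definition trunc w Q f : withTop G :=
  \big[Order.min/Order.top]_(i < size f) w (Qcoef Q f i * Q ^+ i).

Definition val_sim u f g : Prop := u f = u g /\ u f < u (f - g).

Definition val_dvd u f g : Prop := exists h, val_sim u g (f * h).

Definition val_irreducible u f : Prop :=
  forall h q, val_dvd u f (h * q) -> val_dvd u f h \/ val_dvd u f q.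

Definition val_minimal u f : Prop :=
  forall h, val_dvd u f h -> (size f <= size h)%N.

Definition key_polynomial u f : Prop :=
  [/\ f \is monic, val_irreducible u f & val_minimal u f].

(* Qcoef gives the coefficients of the Q-expansion of f *)
Lemma size_Qcoef Q f i : (1 < size Q)%N -> (size (Qcoef Q f i) < size Q)%N.
Proof. by move=> Q1; rewrite ltn_modp -size_poly_gt0 (ltn_trans _ Q1). Qed.

Lemma Qcoef_sum Q f : Q \is monic -> (1 < size Q)%N ->
  f = \sum_(i < size f) Qcoef Q f i * Q ^+ i.
Proof.
move=> Qm Q1; have Q0 : Q != 0 by apply: monic_neq0.
have split n : f = \sum_(i < n) Qcoef Q f i * Q ^+ i + (f %/ Q ^+ n) * Q ^+ n.
  elim: n => [|n IHn]; first by rewrite big_ord0 add0r expr0 divp1 mulr1.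
  rewrite big_ord_recr /= -addrA {1}IHn; congr (_ + _).
  rewrite exprS [Q * _]mulrC -divp_divl mulrA mulrAC -mulrDl; congr (_ * _).
  by rewrite /Qcoef addrC -divp_eq.
rewrite {1}(split (size f)) [f %/ _]divp_small ?mul0r ?addr0 //.
have := size_exp Q (size f); case: (size Q) Q1 => [|[|m]] //= _.
have: Q ^+ size f != 0 by rewrite expf_neq0.
by rewrite -size_poly_gt0; case: (size (Q ^+ _)) => //= k _ ->; rewrite ltnS leq_pmull.
Qed.
End Polynomials.

Definition is_max (T : porderType ring_display) (S : set T) (m : T) : Prop :=
  S m /\ forall s, S s -> s <= m.

Section DistinguishedPairs.
Variables (G : ordQSpace) (K : fieldType) (Kbar : closedFieldType).
Variables (iota : {rmorphism K -> Kbar}) (vbar : Kbar -> withTop G).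
Local Notation deg := (degree iota).

Definition distinguished (t a : Kbar) : Prop :=
  [/\ (deg a < deg t)%N,
      is_max [set vbar (t - b) | b in [set b | (deg b < deg t)%N]]%classic
             (vbar (t - a)) &
      forall c, (deg c < deg a)%N -> vbar (t - c) < vbar (t - a)].

Definition distinguished_poly (g f : {poly K}) : Prop :=
  [/\ irreducible_poly g, irreducible_poly f &
      exists t a, [/\ root (map_poly iota g) t, root (map_poly iota f) a &
                      distinguished t a]].
End DistinguishedPairs.

Notation "x %:F" := (FracField.tofrac x) : ring_scope.

(* restriction to K[X] of a function on K(X) *)
Definition on_poly (G : ordQSpace) (K : fieldType)
    (w : {fraction {poly K}} -> withTop G) (f : {poly K}) : withTop G :=
  w f%:F.

(* Main.v *)
Require Import Defs.
From mathcomp Require Import all_boot all_order all_algebra ring.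
From mathcomp Require Import boolp classical_sets.

Set Implicit Arguments.
Unset Strict Implicit.
Unset Printing Implicit Defensive.

Import Order.TTheory GRing.Theory Num.Theory.
Local Open Scope ring_scope.

(** Write d_b for the b-th Hasse derivative.  Both conditions of the theorem
    are equivalent to

      (star)  deg Q < deg F, and eps f <= eps Q whenever deg f < deg F.

    For the key polynomial condition, put d = eps Q and expand f around the
    generic point: f(X + Y) = sum_b (d_b f) Y^b in K(X)[Y].  The Gauss extension
    of w giving Y the value d sends this series to min_b (w (d_b f) + b d), and
    by the very definition of eps this minimum equals w f exactly when
    eps f <= d.  If deg f < deg Q the minimum is attained only at b = 0, since
    eps f < d; for f = Q it is attained at some b > 0.  The last index where the
    minimum is attained is additive on products, so in a Q-expansion the terms
    f_i Q^i have pairwise distinct last indices, their sum cannot cancel, and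
    the Gauss value of f is min_i w (f_i Q^i), that is the Q-truncation w_Q f
    (gauss_lead_trunc).  Hence w_Q is a valuation below w, and w_Q f = w f if
    and only if eps f <= eps Q (Qtrunc_eq).  A polynomial F with w_Q F < w F is
    a key polynomial for w_Q if and only if no polynomial of smaller degree has
    this property, which is (star) (key_polynomialP).

    For distinguished pairs, let theta be a root of F.  If deg f < deg F then
    w f = vbar (f theta) (on_poly_horner): on polynomials of degree < deg F, w
    is multiplicative modulo F, so the minimal equation of f theta over K is a
    relation between polynomials of known w-values; its Newton polygon has a
    single slope vbar (f theta), because conjugate elements have the same value
    over a henselian field, and this forces w f to be that slope.  Therefore
    eps f is the largest slope of the Newton polygon of f(theta + Y), that is
    the maximum of vbar (theta - b) over the roots b of f.  Condition (star)
    now says that, among all b of degree < deg F, the maximum of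
    vbar (theta - b) is reached at a root of Q (distinguished_eps); that no
    element of degree < deg Q reaches it is the ABKP property of Q.

    The equality of the values of conjugates x, y is obtained by composing vbar
    with a K-embedding of Kbar into itself sending x to y, which Zorn's lemma
    provides (exists_conjugation). *)

(** * Ordered groups with a top element *)

Section OrderedGroup.
Variable G : ordQSpace.
Implicit Types (x y z : G) (a b c d : withTop G).

Lemma leG_add2r z x y : (x + z <= y + z) = (x <= y).
Proof.
have mono (s t r : G) : s <= t -> r + s <= r + t by exact: (@ordQ_addl G r s t).
apply/idP/idP => [/(mono _ _ (- z))|/(mono _ _ z)]; last by rewrite ![z + _]addrC.
by rewrite ![_ + z]addrC !addKr.
Qed.

Lemma ltG_add2r z x y : (x + z < y + z) = (x < y).
Proof. by rewrite !lt_neqAle leG_add2r (inj_eq (addIr z)). Qed.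

Lemma leG_mulrn2r n x y : x <= y -> x *+ n <= y *+ n.
Proof.
move=> xy; elim: n => [|n IH]; first by rewrite !mulr0n.
rewrite !mulrS; apply: (@le_trans _ _ (y + x *+ n)); first by rewrite leG_add2r.
by rewrite ![y + _]addrC leG_add2r.
Qed.

Lemma leG_pmulrn2r n x y : (0 < n)%N -> (x *+ n <= y *+ n) = (x <= y).
Proof.
move=> n0; apply/idP/idP => [|/leG_mulrn2r->//].
apply: contraLR; rewrite -!ltNge => yx; rewrite lt_neqAle leG_mulrn2r ?ltW // andbT.
apply/eqP => /(congr1 ( *:%R (n%:R^-1 : rat))).
have nz : (n%:R : rat) != 0 by rewrite pnatr_eq0 -lt0n.
by rewrite -!(@scaler_nat rat) !scalerA mulVf // !scale1r => E; rewrite E ltxx in yx.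
Qed.

Lemma ltG_mulrn2r n x y : (0 < n)%N -> x < y -> x *+ n < y *+ n.
Proof. by move=> n0; rewrite !ltNge leG_pmulrn2r. Qed.

Lemma divG_mulrn n x : (0 < n)%N -> ((n%:R : rat)^-1 *: x) *+ n = x.
Proof.
move=> n0; have nz : (n%:R : rat) != 0 by rewrite pnatr_eq0 -lt0n.
by rewrite -(@scaler_nat rat) scalerA divff // scale1r.
Qed.

Lemma withTop_le_add2r (x : G) a b : (a + Val x <= b + Val x) = (a <= b).
Proof. by case: a b => [a|] [b|] //; apply: leG_add2r. Qed.

Lemma withTop_lt_add2r (x : G) a b : (a + Val x < b + Val x) = (a < b).
Proof. by rewrite !ltNge withTop_le_add2r. Qed.

Lemma withTop_add_top a : a + Infty = Infty. Proof. by case: a. Qed.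
Lemma withTop_valD x y : Val x + Val y = Val (x + y) :> withTop G. Proof. by []. Qed.

Lemma withTop_leD a b c d : a <= c -> b <= d -> a + b <= c + d.
Proof.
case: c => [c|]; last by move=> _ _; apply: lex1.
case: d => [d|]; last by rewrite withTop_add_top => _ _; apply: lex1.
case: a => [a|] //; case: b => [b|] // ac bd; apply: (@le_trans _ _ (Val a + Val d)).
  by rewrite ![Val a + _]addrC withTop_le_add2r.
by rewrite withTop_le_add2r.
Qed.

Lemma withTop_ltD (y : G) a c d : a < c -> Val y <= d -> a + Val y < c + d.
Proof.
move=> ac yd; apply: (@lt_le_trans _ _ (c + Val y)); first by rewrite withTop_lt_add2r.
exact: withTop_leD.
Qed.

Lemma withTop_valMn x n : (Val x : withTop G) *+ n = Val (x *+ n).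
Proof. by elim: n => [|n IH] //; rewrite !mulrS IH. Qed.

Lemma withTop_finite a : a <> Infty -> exists x : G, a = Val x.
Proof. by case: a => // x _; exists x. Qed.

End OrderedGroup.

Lemma bigmin_ord_recr (T : tOrderType ring_display) n (E : nat -> T) :
  \big[Order.min/Order.top]_(i < n.+1) E i =
  Order.min (\big[Order.min/Order.top]_(i < n) E i) (E n).
Proof.
apply/le_anti/andP; split.
  by rewrite le_min (le_bigmin_ord xpredT) // (bigmin_le _ ord_max).
apply: le_bigmin => [|[i /= i_n] _]; first exact: lex1.
rewrite ge_min; move: i_n; rewrite ltnS leq_eqVlt => /predU1P[->|i_n].
  by rewrite lexx orbT.
by rewrite (bigmin_le _ (Ordinal i_n)).
Qed.

(** * Valuations of a field *)
Section Valuations.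
Variables (G : ordQSpace) (L : fieldType) (u : L -> withTop G) (hu : valuation u).
Implicit Types x y : L.

Lemma valuation0 : u 0 = Infty. Proof. exact/(val_eqoo hu). Qed.

Lemma val_fin x : x != 0 -> exists c, u x = Val c.
Proof. by move/eqP=> x0; apply: withTop_finite => /(val_eqoo hu). Qed.

(** From 2 u(x) = 0 one gets u(x) = 0 because an ordered group is torsion free;
    the case of -1 gives u(- x) = u(x). *)
Lemma val_sqrt1 x : x ^+ 2 = 1 -> u x = Val 0.
Proof.
move=> x1; have x0 : x != 0 by apply: contra_eq_neq x1 => ->; rewrite expr0n eq_sym oner_eq0.
have E1 y : y * y = y -> y != 0 -> u y = Val 0.
  move=> E y0; have [c cE] := val_fin y0; have := val_mul hu y y.
  rewrite E cE => -[/(congr1 (fun z => z - c))]; rewrite subrr addrK => <- //.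
have [c cE] := val_fin x0; have := val_mul hu x x.
rewrite -expr2 x1 E1 ?mulr1 ?oner_neq0 // cE => -[E].
have : (0 *+ 2 <= c *+ 2) && (c *+ 2 <= 0 *+ 2) by rewrite mul0rn mulr2n -E lexx.
by rewrite !leG_pmulrn2r // => /le_anti <-.
Qed.

Lemma valuation1 : u 1 = Val 0. Proof. by rewrite val_sqrt1 ?expr1n. Qed.

Lemma valuationN x : u (- x) = u x.
Proof. by rewrite -mulN1r (val_mul hu) val_sqrt1 ?sqrrN ?expr1n // add0r. Qed.

Lemma valuationX x n : u (x ^+ n) = u x *+ n.
Proof. by elim: n => [|n IH]; rewrite ?valuation1 // exprS (val_mul hu) IH mulrS. Qed.

Lemma val_le_add c x y : c <= u x -> c <= u y -> c <= u (x + y).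
Proof. by move=> cx cy; apply: le_trans (val_add hu x y); rewrite le_min cx. Qed.

Lemma val_lt_add c x y : c < u x -> c < u y -> c < u (x + y).
Proof. by move=> cx cy; apply: lt_le_trans (val_add hu x y); rewrite lt_min cx. Qed.

Lemma val_addl x y : u x < u y -> u (x + y) = u x.
Proof.
move=> xy; apply/le_anti/andP; split; last by rewrite val_le_add // ltW.
rewrite leNgt; apply/negP => h.
by have := val_lt_add h (y := - y); rewrite valuationN addrK ltxx => /(_ xy).
Qed.

Lemma val_sub_lt x y : u x < u (x - y) -> u y = u x.
Proof. by move=> h; rewrite -{1}[y](subKr x) val_addl // valuationN. Qed.

Lemma val_le_sum (I : Type) (r : seq I) (P : pred I) (E : I -> L) c :
  (forall i, P i -> c <= u (E i)) -> c <= u (\sum_(i <- r | P i) E i).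
Proof.
move=> h; elim/big_rec: _ => [|i x Pi cx]; first by rewrite valuation0 lex1.
by rewrite val_le_add ?h.
Qed.

Lemma val_lt_sum (I : Type) (r : seq I) (P : pred I) (E : I -> L) (c : G) :
  (forall i, P i -> Val c < u (E i)) -> Val c < u (\sum_(i <- r | P i) E i).
Proof.
move=> h; elim/big_rec: _ => [|i x Pi cx]; first by rewrite valuation0.
by rewrite val_lt_add ?h.
Qed.

Lemma val_sum_dominant (I : finType) (j : I) (E : I -> L) (c : G) :
  u (E j) = Val c -> (forall i, i != j -> Val c < u (E i)) ->
  u (\sum_i E i) = Val c.
Proof.
by move=> jc h; rewrite (bigD1 j) //= val_addl ?jc // val_lt_sum.
Qed.

End Valuations.

(** * Gauss extensions and their leading index *)
Section GaussValuation.
Variables (G : ordQSpace) (L : fieldType) (u : L -> withTop G) (hu : valuation u).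
Variable d : G.
Implicit Types (g h : {poly L}) (c : G) (l : nat).

Definition gauss_term g i : withTop G := u g`_i + Val (d *+ i).

(** The Gauss extension of u to polynomials in Y with Y of value d takes the
    value c at g, and l is the last index where the defining minimum is attained.
    Keeping l next to c is what detects that sums do not cancel. *)
Definition gauss_lead g c l : Prop :=
  [/\ forall i, Val c <= gauss_term g i, gauss_term g l = Val c &
      forall i, (l < i)%N -> Val c < gauss_term g i].

Lemma gauss_lead_uniq g c l c' l' :
  gauss_lead g c l -> gauss_lead g c' l' -> c = c' /\ l = l'.
Proof.
move=> [m e s] [m' e' s'].
have cc : Val c = Val c' :> withTop G.
  by have := m l'; have := m' l; rewrite e e' => a b; apply/le_anti; rewrite a b.
have [cE] := cc; split=> //; apply/eqP; case: (ltngtP l l') => // [/s|/s'].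
  by rewrite cc e' ltxx.
by rewrite -cc e ltxx.
Qed.

Lemma gauss_term_mul g h n i : (i <= n)%N ->
  u (g`_i * h`_(n - i)) + Val (d *+ n) = gauss_term g i + gauss_term h (n - i).
Proof.
by move=> i_n; rewrite -{2}(subnKC i_n) (val_mul hu) mulrnDr -withTop_valD addrACA.
Qed.

(** Gauss's lemma: in the coefficient of index l + l' of the product, any summand
    other than g_l h_l' has an index beyond l or beyond l', hence a larger value. *)
Lemma gauss_lead_mul g h c c' l l' :
  gauss_lead g c l -> gauss_lead h c' l' -> gauss_lead (g * h) (c + c') (l + l').
Proof.
move=> [m e s] [m' e' s'].
have shift (x : L) n (z : G) : (Val z <= u x + Val (d *+ n)) = (Val (z - d *+ n) <= u x).
  by rewrite -(withTop_le_add2r (d *+ n) (Val (z - _))) withTop_valD subrK.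
have shiftlt (x : L) n (z : G) : (Val z < u x + Val (d *+ n)) = (Val (z - d *+ n) < u x).
  by rewrite -(withTop_lt_add2r (d *+ n) (Val (z - _))) withTop_valD subrK.
have le0 i j : Val (c + c') <= gauss_term g i + gauss_term h j.
  by rewrite -withTop_valD withTop_leD.
have lt0 i j : (l < i)%N || (l' < j)%N -> Val (c + c') < gauss_term g i + gauss_term h j.
  rewrite -withTop_valD; case/orP => h0; first by rewrite withTop_ltD ?s.
  by rewrite addrC [gauss_term g i + _]addrC withTop_ltD ?s'.
split.
- move=> n; rewrite /gauss_term shift coefM val_le_sum // => i _.
  by rewrite -shift gauss_term_mul ?(ltnSE (ltn_ord i)) //.
- have ln : (l < (l + l').+1)%N by rewrite ltnS leq_addr.
  rewrite /gauss_term; have -> : u (g * h)`_(l + l') = Val (c + c' - d *+ (l + l')).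
    rewrite coefM; apply: (val_sum_dominant hu (j := Ordinal ln)) => /=.
      have := gauss_term_mul g h (leq_addr l' l); rewrite addKn e e' withTop_valD.
      by case: (u _) => [y|] //= [<-]; rewrite addrK.
    move=> i; rewrite -shiftlt gauss_term_mul ?(ltnSE (ltn_ord i)) // -val_eqE /= => il.
    apply: lt0; have := ltnSE (ltn_ord i); move: il; case: ltngtP => //= il _ ile.
    by rewrite -(ltn_add2l i) subnKC // ltn_add2r.
  by rewrite withTop_valD subrK.
- move=> n ln; rewrite /gauss_term shiftlt coefM val_lt_sum // => i _.
  rewrite -shiftlt gauss_term_mul ?(ltnSE (ltn_ord i)) //; apply: lt0.
  case: (ltnP l i) => //= il; rewrite -(ltn_add2l i) subnKC ?(ltnSE (ltn_ord i)) //.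
  by apply: leq_ltn_trans ln; rewrite leq_add2r.
Qed.

Lemma gauss_term_le_add g h (c : withTop G) i :
  c <= gauss_term g i -> c <= gauss_term h i -> c <= gauss_term (g + h) i.
Proof.
rewrite /gauss_term coefD => cg ch.
apply: (@le_trans _ _ (Order.min (u g`_i) (u h`_i) + Val (d *+ i))).
  by case: (leP (u g`_i) (u h`_i)).
by rewrite withTop_le_add2r (val_add hu).
Qed.

Lemma gauss_term_lt_add g h (c : withTop G) i :
  c < gauss_term g i -> c < gauss_term h i -> c < gauss_term (g + h) i.
Proof.
rewrite /gauss_term coefD => cg ch.
apply: (@lt_le_trans _ _ (Order.min (u g`_i) (u h`_i) + Val (d *+ i))).
  by case: (leP (u g`_i) (u h`_i)).
by rewrite withTop_le_add2r (val_add hu).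
Qed.

(** At the index l the coefficient of g strictly dominates that of h, which
    blocks any cancellation there. *)
Lemma gauss_lead_dominant g h c l : gauss_lead g c l ->
  (forall i, Val c <= gauss_term h i) ->
  (forall i, (l <= i)%N -> Val c < gauss_term h i) ->
  gauss_lead (g + h) c l.
Proof.
move=> [m e s] m' s'; split=> [i||i li].
- exact: gauss_term_le_add.
- rewrite -e /gauss_term coefD val_addl //.
  by rewrite -(withTop_lt_add2r (d *+ l)) [X in X < _]e s'.
- by rewrite gauss_term_lt_add ?s ?s' // ltnW.
Qed.

(** Different leading indices prevent cancellation: among the summands of
    smallest value, the one with the larger index survives. *)
Lemma gauss_lead_add g h c c' l l' :
  gauss_lead g c l -> gauss_lead h c' l' -> (l < l')%N ->
  gauss_lead (g + h) (Order.min c c') (if c < c' then l else l').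
Proof.
move=> ng nh ll; have [m e s] := ng; have [m' e' s'] := nh.
case: (ltP c c') => cc.
  apply: gauss_lead_dominant => // i *; last exact: lt_le_trans (m' i).
  by apply: le_trans (m' i); apply: ltW.
rewrite addrC; apply: gauss_lead_dominant => // i *; first exact: le_trans (m i).
by apply: le_lt_trans (s _ _) => //; apply: leq_trans ll _.
Qed.

Lemma gauss_lead_exp g c l n :
  gauss_lead g c l -> gauss_lead (g ^+ n) (c *+ n) (l * n).
Proof.
move=> ng; elim: n => [|n IH]; last first.
  by rewrite exprS mulrS mulnS; apply: gauss_lead_mul.
rewrite mulr0n muln0 expr0; split=> [[|i]||[|i] _] //; rewrite /gauss_term coef1.
- by rewrite valuation1 // withTop_valD addr0.
- by rewrite valuation0 // lex1.
- by rewrite valuation1 // withTop_valD addr0.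
- by rewrite valuation0.
Qed.

End GaussValuation.

(** * The invariant eps as a slope condition *)
Section Eps.
Variables (G : ordQSpace) (K : fieldType) (u : {poly K} -> withTop G).
Implicit Types (f : {poly K}) (x d : G).

Lemma eps_term_le f b x d : (0 < b)%N -> u f = Val x ->
  (eps_term u f b <= BVal d) = (Val x <= u f^`N(b) + Val (d *+ b)).
Proof.
move=> b0 fx; rewrite /eps_term fx; case: (u _) => [y|] //.
have -> : (Val x <= Val y + Val (d *+ b)) = (x - y <= d *+ b).
  by rewrite withTop_valD -(leG_add2r y (x - y)) subrK addrC.
rewrite -[LHS]/(_ *: (x - y) <= d).
by rewrite -[LHS](leG_pmulrn2r _ _ b0) divG_mulrn.
Qed.

Lemma eps_term_lt f b x d : (0 < b)%N -> u f = Val x ->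
  (eps_term u f b < BVal d) = (Val x < u f^`N(b) + Val (d *+ b)).
Proof.
move=> b0 fx; rewrite /eps_term fx; case: (u _) => [y|] //.
have -> : (Val x < Val y + Val (d *+ b)) = (x - y < d *+ b).
  by rewrite withTop_valD -(ltG_add2r y (x - y)) subrK addrC.
rewrite [LHS]ltNge [RHS]ltNge -[X in ~~ X = _]/(d <= _ *: (x - y)).
rewrite -[X in ~~ X = _](leG_pmulrn2r _ _ b0).
by rewrite divG_mulrn.
Qed.

Hypothesis u0 : u 0 = Infty.

Lemma eps_le f x d : u f = Val x ->
  eps u f <= BVal d <-> forall b, (0 < b)%N -> Val x <= u f^`N(b) + Val (d *+ b).
Proof.
move=> fx; split=> [le_d b b0|h].
  case: (ltnP b (size f)) => [bs|sb]; last by rewrite nderivn_poly0 // u0 lex1.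
  rewrite -(eps_term_le _ b0 fx); apply: le_trans le_d.
  by rewrite le_bigmax_seq // mem_index_iota b0.
rewrite /eps big_seq; apply: bigmax_le => [|b]; rewrite ?le0x // mem_index_iota.
by case/andP=> b0 _; rewrite (eps_term_le _ b0 fx) h.
Qed.

Lemma eps_lt f x d : u f = Val x ->
  eps u f < BVal d <-> forall b, (0 < b)%N -> Val x < u f^`N(b) + Val (d *+ b).
Proof.
move=> fx; split=> [le_d b b0|h].
  case: (ltnP b (size f)) => [bs|sb]; last by rewrite nderivn_poly0 // u0.
  rewrite -(eps_term_lt _ b0 fx); apply: le_lt_trans le_d.
  by rewrite le_bigmax_seq // mem_index_iota b0.
rewrite /eps big_seq; apply: bigmax_lt => [|b] //; rewrite mem_index_iota.
by case/andP=> b0 _; rewrite (eps_term_lt _ b0 fx) h.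
Qed.

Lemma eps_top f : u f = Infty -> eps u f = NInfty.
Proof. by move=> fx; rewrite /eps bigmax_eq_id // => b _; rewrite /eps_term fx. Qed.

End Eps.

(** * Taylor expansions *)
Lemma nderivn_deg (R : comNzRingType) (p : {poly R}) :
  p^`N((size p).-1) = (lead_coef p)%:P.
Proof.
apply/polyP => i; rewrite coef_nderivn coefC lead_coefE.
case: i => [|i]; first by rewrite addn0 binn mulr1n.
rewrite nth_default ?mul0rn //= addnS.
by case: (size p) => // n; rewrite ltnS leq_addr.
Qed.

Lemma size_nderivn_le (R : comNzRingType) (p : {poly R}) n : (size p^`N(n) <= size p)%N.
Proof.
apply/leq_sizeP => i le; rewrite coef_nderivn nth_default ?mul0rn //.
exact: leq_trans le (leq_addl _ _).
Qed.

Section Taylor.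
Variables (L : fieldType).

Definition taylor (t : L) (f : {poly L}) : {poly L} := f \Po ('X + t%:P).

(** Taylor's formula, applied over the ring of polynomials to the point t and the
    increment 'X. *)
Lemma coef_taylor t f b : (taylor t f)`_b = f^`N(b).[t].
Proof.
have -> : taylor t f = \poly_(i < size f) f^`N(i).[t].
  rewrite /taylor /comp_poly addrC nderiv_taylor; last exact: mulrC.
  rewrite size_map_polyC poly_def; apply: eq_bigr => i _.
  by rewrite nderivn_map horner_map /= -mul_polyC.
by rewrite coef_poly; case: ltnP => // sb; rewrite nderivn_poly0 ?horner0.
Qed.
End Taylor.

Section Generic.
Variables (K : fieldType).
Local Notation KX := {fraction {poly K}}.

(** The expansion of f(X + Y) in powers of Y: f is viewed with coefficients in
    K(X), and the variable 'X of the outer polynomial ring is Y. *)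
Definition generic_taylor (f : {poly K}) : {poly KX} :=
  taylor ('X%:F) (map_poly (@FracField.tofrac {poly K} \o polyC) f).

Lemma coef_generic_taylor f b : (generic_taylor f)`_b = (f^`N(b))%:F.
Proof.
rewrite coef_taylor nderivn_map map_poly_comp.
by rewrite horner_map /= -[_.['X]]/(_ \Po 'X) comp_polyXr.
Qed.

Lemma generic_taylorM f g :
  generic_taylor (f * g) = generic_taylor f * generic_taylor g.
Proof. by rewrite /generic_taylor /taylor rmorphM /= rmorphM. Qed.

Lemma generic_taylorX f n : generic_taylor (f ^+ n) = generic_taylor f ^+ n.
Proof. by rewrite /generic_taylor /taylor rmorphXn /= rmorphXn. Qed.

Lemma generic_taylorD f g :
  generic_taylor (f + g) = generic_taylor f + generic_taylor g.
Proof. by rewrite /generic_taylor /taylor rmorphD /= rmorphD. Qed.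

Lemma generic_taylor0 : generic_taylor 0 = 0.
Proof. by rewrite /generic_taylor /taylor !rmorph0. Qed.
End Generic.

(** * The Q-truncation is a Gauss valuation *)
Section Truncation.
Variables (G : ordQSpace) (K : fieldType).
Variables (w : {fraction {poly K}} -> withTop G) (hw : valuation w).
Local Notation wp := (on_poly w).
Implicit Types (f g Q : {poly K}) (c d : G).

Lemma on_poly0 : wp 0 = Infty.
Proof. by rewrite /on_poly rmorph0 valuation0. Qed.

Lemma on_poly_fin f : f != 0 -> exists c, wp f = Val c.
Proof. by move=> f0; apply: val_fin => //; rewrite tofrac_eq0. Qed.

Lemma on_polyM f g : wp (f * g) = wp f + wp g.
Proof. by rewrite /on_poly rmorphM (val_mul hw). Qed.

Lemma gauss_term_generic d f i :
  gauss_term w d (generic_taylor f) i = wp f^`N(i) + Val (d *+ i).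
Proof. by rewrite /gauss_term coef_generic_taylor. Qed.

(** The derivative of order deg Q is the leading coefficient 1, so the maximum
    defining eps Q has a term other than - oo. *)
Lemma ABKP_eps Q : ABKP wp Q -> exists d, eps wp Q = BVal d.
Proof.
move=> [Qm Q1 _]; have [x Qx] := on_poly_fin (monic_neq0 Qm).
case E: (eps wp Q) => [|d]; last by exists d.
have n0 : (0 < (size Q).-1)%N by case: (size Q) Q1 => [|[]].
have : eps_term wp Q (size Q).-1 <= eps wp Q.
  by rewrite le_bigmax_seq // mem_index_iota n0 /= prednK // (ltn_trans _ Q1).
rewrite E /eps_term Qx nderivn_deg (monicP Qm) /on_poly.
by rewrite rmorph1 (valuation1 hw).
Qed.

Section FixedKey.
Variables (Q : {poly K}) (hQ : ABKP wp Q) (d : G) (Qd : eps wp Q = BVal d).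

(** By the ABKP property eps f < eps Q = d, which says that the terms of positive
    index are strictly larger than the term of index 0. *)
Lemma gauss_lead_small f c : (size f < size Q)%N -> wp f = Val c ->
  gauss_lead w d (generic_taylor f) c 0.
Proof.
move=> sfQ fc; have [_ _ minQ] := hQ.
have small b : (0 < b)%N -> Val c < gauss_term w d (generic_taylor f) b.
  rewrite gauss_term_generic; apply: (eps_lt on_poly0 d fc).1.
  by rewrite -Qd ltNge; apply: contraL sfQ => /minQ; rewrite -leqNgt.
split=> [[|b]||//]; rewrite ?gauss_term_generic ?nderivn0 ?fc ?addr0 //.
by rewrite -gauss_term_generic ltW ?small.
Qed.

(** If the minimum were attained at 0 only, eps Q would be smaller than d. *)
Lemma gauss_lead_key : exists q k,
  [/\ wp Q = Val q, gauss_lead w d (generic_taylor Q) q k & (0 < k)%N].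
Proof.
have [Qm Q1 minQ] := hQ; have Q0 := monic_neq0 Qm.
have [q Qq] := on_poly_fin Q0; exists q.
have le b : Val q <= gauss_term w d (generic_taylor Q) b.
  case: b => [|b]; first by rewrite gauss_term_generic nderivn0 Qq addr0.
  by rewrite gauss_term_generic; apply: (eps_le on_poly0 d Qq).1 => //; rewrite Qd.
pose P b := gauss_term w d (generic_taylor Q) b == Val q.
have P0 : P 0%N by rewrite /P gauss_term_generic nderivn0 Qq withTop_valD addr0.
have bound b : P b -> (b <= size Q)%N.
  apply: contraLR; rewrite -ltnNge /P gauss_term_generic => sb.
  by rewrite nderivn_poly0 ?on_poly0 // ltnW.
have exP : exists b, P b by exists 0%N.
case: (ex_maxnP exP bound) => k /eqP Pk kmax.
exists k; have nk : gauss_lead w d (generic_taylor Q) q k.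
  split=> // i ki; rewrite lt_neqAle le andbT.
  by apply: contraL ki => /eqP E; rewrite -leqNgt kmax // /P -E.
split=> //; rewrite lt0n; apply/eqP => k0; move: nk; rewrite k0 => -[_ _ lt].
have : eps wp Q < BVal d.
  by apply/(eps_lt on_poly0 d Qq) => b b0; rewrite -gauss_term_generic lt.
by rewrite Qd ltxx.
Qed.

(** The term of index i of the Q-expansion has leading index i k, where k > 0 is
    that of Q.  These indices increase strictly with i, so by gauss_lead_add the
    Gauss value of the partial sums is the minimum of the values of the terms. *)
Lemma gauss_lead_trunc f : f != 0 ->
  exists c l, trunc wp Q f = Val c /\ gauss_lead w d (generic_taylor f) c l.
Proof.
move=> f0; have [Qm Q1 _] := hQ; have [q [k [Qq nQ k0]]] := gauss_lead_key.
pose S n := \sum_(i < n) Qcoef Q f i * Q ^+ i.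
pose m n := \big[Order.min/Order.top]_(i < n) wp (Qcoef Q f i * Q ^+ i).
have main n : (S n = 0 /\ m n = Infty) \/
   exists c l, [/\ m n = Val c, gauss_lead w d (generic_taylor (S n)) c l & (l < n * k)%N].
  elim: n => [|n IH]; first by left; rewrite /S /m !big_ord0.
  have [SE mE] : S n.+1 = S n + Qcoef Q f n * Q ^+ n /\
      m n.+1 = Order.min (m n) (wp (Qcoef Q f n * Q ^+ n)).
    split; first by rewrite /S big_ord_recr.
    exact: (@bigmin_ord_recr _ _ (fun i => wp (Qcoef Q f i * Q ^+ i))).
  have [fn0|fn0] := eqVneq (Qcoef Q f n) 0.
    move: SE mE; rewrite fn0 mul0r addr0 on_poly0 (minEle (m n)) lex1 => -> ->.
    case: IH => [IH|[c [l [mc nl lk]]]]; [by left | right].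
    by exists c, l; rewrite (leq_trans lk) // leq_mul2r leqnSn orbT.
  have [c' fc'] := on_poly_fin fn0; right.
  have nn : gauss_lead w d (generic_taylor (Qcoef Q f n * Q ^+ n)) (c' + q *+ n) (n * k).
    rewrite generic_taylorM generic_taylorX -[(n * k)%N]add0n mulnC.
    apply: gauss_lead_mul => //; last exact: gauss_lead_exp.
    by apply: gauss_lead_small => //; apply: size_Qcoef.
  have vn : wp (Qcoef Q f n * Q ^+ n) = Val (c' + q *+ n).
    have -> : wp (Qcoef Q f n * Q ^+ n) = wp (Qcoef Q f n) + wp Q *+ n.
      by rewrite on_polyM /on_poly rmorphXn (valuationX hw).
    by rewrite fc' Qq withTop_valMn.
  case: IH => [[S0 m0]|[c [l [mc nl lk]]]].
    exists (c' + q *+ n), (n * k)%N; rewrite SE mE S0 m0 add0r vn; split=> //.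
    by rewrite ltn_pmul2r.
  have nl' := gauss_lead_add hw nl nn lk.
  exists (Order.min c (c' + q *+ n)).
  exists (if c < c' + q *+ n then l else (n * k)%N).
  rewrite SE mE mc vn generic_taylorD; split=> //.
    by rewrite !minEle -[Val c <= Val _]/(c <= _); case: ifP.
  have nk : (n * k < n.+1 * k)%N by rewrite ltn_pmul2r.
  by case: ifP => // _; apply: ltn_trans lk nk.
have fS : S (size f) = f by rewrite /S -Qcoef_sum.
case: (main (size f)) => [[S0]|[c [l [mc nl _]]]].
  by move: f0; rewrite -fS S0 eqxx.
by rewrite fS in nl; exists c, l; split; first exact: mc.
Qed.

Lemma Qtrunc0 : trunc wp Q 0 = Infty.
Proof. by rewrite /trunc size_poly0 big_ord0. Qed.

Lemma Qtrunc_fin f : f != 0 -> exists c, trunc wp Q f = Val c.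
Proof. by case/gauss_lead_trunc => c [l [fc _]]; exists c. Qed.

Lemma QtruncM f g : trunc wp Q (f * g) = trunc wp Q f + trunc wp Q g.
Proof.
have [->|f0] := eqVneq f 0; first by rewrite mul0r Qtrunc0.
have [->|g0] := eqVneq g 0; first by rewrite mulr0 Qtrunc0 withTop_add_top.
have [c [l [fc nf]]] := gauss_lead_trunc f0.
have [c' [l' [gc ng]]] := gauss_lead_trunc g0.
have [e [j [fge nfg]]] := gauss_lead_trunc (mulf_neq0 f0 g0).
have := gauss_lead_mul hw nf ng; rewrite -generic_taylorM => /(gauss_lead_uniq nfg)[E _].
by rewrite fge fc gc withTop_valD E.
Qed.

(** The value w f is the term of index 0 of the Gauss value. *)
Lemma Qtrunc_le f : trunc wp Q f <= wp f.
Proof.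
have [->|f0] := eqVneq f 0; first by rewrite Qtrunc0 on_poly0.
have [c [l [fc [le _ _]]]] := gauss_lead_trunc f0.
by have := le 0%N; rewrite gauss_term_generic nderivn0 addr0 fc.
Qed.

Lemma Qtrunc_le_add (a : withTop G) f g :
  a <= trunc wp Q f -> a <= trunc wp Q g -> a <= trunc wp Q (f + g).
Proof.
have [->|fg0] := eqVneq (f + g) 0; first by rewrite Qtrunc0 lex1.
have [c [l [fgc [_ fgl _]]]] := gauss_lead_trunc fg0.
rewrite fgc -fgl generic_taylorD => af ag.
have main h : a <= trunc wp Q h -> a <= gauss_term w d (generic_taylor h) l.
  have [->|h0] := eqVneq h 0.
    by rewrite generic_taylor0 /gauss_term coef0 valuation0 //= lex1.
  by have [e [j [-> [le _ _]]]] := gauss_lead_trunc h0; move/le_trans; apply.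
by rewrite (gauss_term_le_add hw) ?main.
Qed.

Lemma QtruncN f : trunc wp Q (- f) = trunc wp Q f.
Proof.
have le g : trunc wp Q g <= trunc wp Q (- g).
  have := QtruncM (-1) g; rewrite mulN1r => ->.
  suff -> : trunc wp Q (-1) = Val 0 by rewrite add0r.
  have s1 : (size (-1 : {poly K})%R < size Q)%N.
    by rewrite size_polyN size_poly1; case: hQ.
  have w1 : wp (-1) = Val 0.
    by rewrite /on_poly rmorphN1 (val_sqrt1 hw) // sqrrN expr1n.
  have [|c [l [-> nc]]] := @gauss_lead_trunc (-1); first by rewrite oppr_eq0 oner_eq0.
  by have [-> _] := gauss_lead_uniq nc (gauss_lead_small s1 w1).
by apply/le_anti; rewrite le andbT -{2}[f]opprK le.
Qed.

(** The Gauss value of f is its term of index 0, namely w f, exactly when no term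
    of positive index is smaller; this is the slope condition eps_le. *)
Lemma Qtrunc_eq f : trunc wp Q f = wp f <-> eps wp f <= BVal d.
Proof.
have [->|f0] := eqVneq f 0.
  by rewrite Qtrunc0 on_poly0 eps_top ?on_poly0 //; split.
have [x fx] := on_poly_fin f0; have [c [l [fc [le e lt]]]] := gauss_lead_trunc f0.
rewrite fx fc (eps_le on_poly0 d fx); split=> [[<-] b _|h].
  by rewrite -gauss_term_generic.
apply/le_anti; rewrite -fx -fc Qtrunc_le fc -e gauss_term_generic.
by case: (l) => [|b]; rewrite ?nderivn0 ?addr0 ?lexx // fx h.
Qed.

End FixedKey.

End Truncation.

(** * Key polynomials of the truncation *)
Section KeyPolynomials.
Variables (G : ordQSpace) (K : fieldType).
Variables (w : {fraction {poly K}} -> withTop G) (hw : valuation w).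
Local Notation wp := (on_poly w).
Variables (Q : {poly K}) (hQ : ABKP wp Q).
Implicit Types (f g h q F : {poly K}) (a : withTop G).
Local Notation t := (trunc wp Q).

(** Two factors of degree < deg Q would have leading index 0, and so would their
    product Q, contradicting gauss_lead_key. *)
Lemma ABKP_irreducible : irreducible_poly Q.
Proof.
have [d Qd] := ABKP_eps hw hQ.
have [Qm Q1 _] := hQ; have Q0 := monic_neq0 Qm.
split=> // q q1 qQ; rewrite -dvdp_size_eqp //; apply: contraT => sqQ.
have {}sqQ : (size q < size Q)%N by rewrite ltn_neqAle sqQ dvdp_leq.
have QE := divpK qQ; set r := Q %/ q in QE.
have q0 : q != 0 by apply: contraNneq Q0 => q0; rewrite -QE q0 mulr0.
have r0 : r != 0 by apply: contraNneq Q0 => r0; rewrite -QE r0 mul0r.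
have srQ : (size r < size Q)%N.
  have := q0; rewrite -size_poly_gt0; have := r0; rewrite -size_poly_gt0.
  rewrite -QE size_mul //; move: q1; case: (size q) => [|[|n]] //.
  by case: (size r) => // m _ _ _; rewrite addnS /= addSn ltnS addnS ltnS leq_addr.
have [c rc] := on_poly_fin hw r0; have [c' qc] := on_poly_fin hw q0.
have small := gauss_lead_small hw hQ Qd.
have := gauss_lead_mul hw (small _ _ srQ rc) (small _ _ sqQ qc).
rewrite -generic_taylorM QE; have [e [k [_ nQ k0]]] := gauss_lead_key hw hQ Qd.
by move/(gauss_lead_uniq nQ) => [_ kE]; move: k0; rewrite kE.
Qed.

(** In f g = q Q + r the leading index of f g is 0 and that of q Q is positive;
    so the value of f g must come from r alone. *)
Lemma ABKP_mul_rem f g : (size f < size Q)%N -> (size g < size Q)%N ->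
  wp ((f * g) %% Q) = wp (f * g).
Proof.
move=> sf sg; have [d Qd] := ABKP_eps hw hQ.
have [Qm Q1 _] := hQ; have Q0 := monic_neq0 Qm.
have [->|f0] := eqVneq f 0; first by rewrite mul0r mod0p.
have [->|g0] := eqVneq g 0; first by rewrite mulr0 mod0p.
have fgE := divp_eq (f * g) Q.
have [q0|q0] := eqVneq ((f * g) %/ Q) 0.
  by rewrite {2}fgE q0 mul0r add0r.
have sq : (size ((f * g) %/ Q)%R < size Q)%N.
  rewrite size_divp // size_mul //.
  have := f0; rewrite -size_poly_gt0; have := g0; rewrite -size_poly_gt0.
  move: sf sg; case: (size f) => // m; case: (size g) => // n; case: (size Q) => // s.
  rewrite addSn addnS /= !ltnS => ms ns _ _; rewrite leq_subLR.
  by apply: leq_trans (leq_add ms (ltnW ns)) _; rewrite leq_add2l.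
have [cf fc] := on_poly_fin hw f0; have [cg gc] := on_poly_fin hw g0.
have [cq qc] := on_poly_fin hw q0.
have small := gauss_lead_small hw hQ Qd.
have nfg := gauss_lead_mul hw (small _ _ sf fc) (small _ _ sg gc).
rewrite -generic_taylorM in nfg.
have [e [k [_ nQ k0]]] := gauss_lead_key hw hQ Qd.
have nqQ := gauss_lead_mul hw (small _ _ sq qc) nQ.
rewrite -generic_taylorM add0n in nqQ.
have [r0|r0] := eqVneq ((f * g) %% Q) 0.
  rewrite r0 addr0 in fgE; rewrite fgE in nfg.
  by have [_ kE] := gauss_lead_uniq nqQ nfg; move: k0; rewrite kE.
have [cr rc] := on_poly_fin hw r0.
have nr := small _ _ (ltn_modpN0 (f * g) Q0) rc.
have := gauss_lead_add hw nr nqQ k0; rewrite -generic_taylorD addrC -fgE.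
move/(gauss_lead_uniq nfg) => [E]; rewrite rc on_polyM // fc gc withTop_valD E.
by case: ltP => // _ kE; move: k0; rewrite -kE.
Qed.

Lemma Qtrunc_lt_add a f g : a < t f -> a < t g -> a < t (f + g).
Proof.
have [d Qd] := ABKP_eps hw hQ => af ag.
apply: (@lt_le_trans _ _ (Order.min (t f) (t g))); first by rewrite lt_min af.
by apply: (Qtrunc_le_add hw hQ Qd); rewrite ge_min lexx ?orbT.
Qed.

Lemma Qtrunc_sub_lt f g : t f < t (f - g) -> t g = t f.
Proof.
have [d Qd] := ABKP_eps hw hQ => lt; apply/le_anti/andP; split; last first.
  rewrite -[X in _ <= t X](subKr f).
  by rewrite (Qtrunc_le_add hw hQ Qd) ?(QtruncN hw hQ Qd) // ltW.
rewrite leNgt; apply/negP => fg.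
by have := Qtrunc_lt_add lt fg; rewrite subrK ltxx.
Qed.

Lemma Qtrunc_mul_lt f g : t f < wp f -> g != 0 -> t (f * g) < wp (f * g).
Proof.
have [d Qd] := ABKP_eps hw hQ; move=> lt g0.
have [c gc] := Qtrunc_fin hw hQ Qd g0.
by rewrite (QtruncM hw hQ Qd) (on_polyM hw) gc withTop_ltD // -gc (Qtrunc_le hw hQ Qd).
Qed.

Lemma Qtrunc_lt_dvd F h : t F < wp F -> val_dvd t F h -> t h < wp h.
Proof.
have [d Qd] := ABKP_eps hw hQ; move=> ltF [q [hE hlt]].
have q0 : q != 0.
  apply: contraTneq hlt => q0; rewrite hE q0 mulr0 Qtrunc0.
  by rewrite -leNgt lex1.
rewrite -[X in wp X](subrK (F * q)) /on_poly rmorphD; apply: val_lt_add => //.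
  exact: lt_le_trans (Qtrunc_le hw hQ Qd _).
by rewrite hE Qtrunc_mul_lt.
Qed.

(** Let h = F q + r.  The remainder satisfies t r = w r by minimality of F.  If
    t r <= t h, both h and F q would have w-value larger than t r, hence so
    would r: contradiction.  Thus h and F q have the same initial form for t. *)
Lemma Qtrunc_dvd F h : t F < wp F ->
  (forall f, (size f < size F)%N -> t f = wp f) -> t h < wp h -> val_dvd t F h.
Proof.
have [d Qd] := ABKP_eps hw hQ; move=> ltF minF lth.
have F0 : F != 0 by apply: contraTneq ltF => ->; rewrite Qtrunc0 on_poly0 ?ltxx.
have hE := divp_eq h F; set q := h %/ F in hE; set r := h %% F in hE.
have rE : h - F * q = r by rewrite {1}hE mulrC addrC addKr.
have sr : (size r < size F)%N by rewrite ltn_modpN0.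
have q0 : q != 0.
  apply: contraTneq lth => q0; rewrite hE q0 mul0r add0r minF ?ltxx //.
suff lt : t h < t r.
  by exists q; split; rewrite ?rE // -rE in lt *; rewrite -(Qtrunc_sub_lt lt).
rewrite ltNge; apply/negP => le.
suff : t r < wp r by rewrite minF ?ltxx.
rewrite -[X in wp X]rE /on_poly rmorphB; apply: val_lt_add => //.
  exact: le_lt_trans lth.
rewrite (valuationN hw); apply: le_lt_trans (Qtrunc_mul_lt ltF q0).
have -> : F * q = h - r by rewrite -rE subKr.
by rewrite (Qtrunc_le_add hw hQ Qd) ?(QtruncN hw hQ Qd).
Qed.

(** By Qtrunc_dvd and Qtrunc_lt_dvd, h is divisible by F for t if and only if
    t h < w h; as t and w are multiplicative, this holds for a product only if it
    holds for one of the factors. *)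
Lemma key_polynomial_of_minimal F : F \is monic -> t F < wp F ->
  (forall f, (size f < size F)%N -> t f = wp f) -> key_polynomial t F.
Proof.
have [d Qd] := ABKP_eps hw hQ; move=> Fm ltF minF; split=> // [h q|h] dvd.
  have lt := Qtrunc_lt_dvd ltF dvd.
  have [lth|leh] := ltP (t h) (wp h); first by left; apply: Qtrunc_dvd.
  have [ltq|leq] := ltP (t q) (wp q); first by right; apply: Qtrunc_dvd.
  have le := Qtrunc_le hw hQ Qd.
  have hE : t h = wp h by apply/le_anti; rewrite le.
  have qE : t q = wp q by apply/le_anti; rewrite le.
  by move: lt; rewrite (QtruncM hw hQ Qd) (on_polyM hw) hE qE ltxx.
rewrite leqNgt; apply/negP => /minF hE.
by have := Qtrunc_lt_dvd ltF dvd; rewrite hE ltxx.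
Qed.

(** Let g be of smallest degree with t g < w g.  Then F ~ g h by Qtrunc_dvd, and
    irreducibility gives either F | g, so deg F <= deg g by minimality of F, or
    F | h.  In the latter case h ~ F q and F ~ g q F, so g q would be equivalent
    to 1, although its t-value and w-value differ. *)
Lemma minimal_of_key_polynomial F : key_polynomial t F -> t F < wp F ->
  forall f, (size f < size F)%N -> t f = wp f.
Proof.
have [d Qd] := ABKP_eps hw hQ; have le := Qtrunc_le hw hQ Qd.
have tM := QtruncM hw hQ Qd.
move=> [Fm irrF minF] ltF f.
have [n] := ubnP (size f); elim: n f => // n IH g sgn sgF.
apply/le_anti; rewrite le /= leNgt; apply/negP => ltg.
have ming f : (size f < size g)%N -> t f = wp f.
  move=> sfg; apply: IH; last exact: ltn_trans sgF.
  exact: leq_trans sfg _.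
have [h [FE Flt]] := Qtrunc_dvd ltg ming ltF.
have /irrF [/minF|[q [hE hlt]]] : val_dvd t F (g * h).
- by exists 1; rewrite mulr1; split; rewrite -?FE // -opprB (QtruncN hw hQ Qd).
- by rewrite leqNgt sgF.
(* From here on F divides h, and 1 - g q is shown to have positive value. *)
have [x Fx] := Qtrunc_fin hw hQ Qd (monic_neq0 Fm).
have g0 : g != 0 by apply: contraTneq ltg => ->; rewrite Qtrunc0 on_poly0 ?ltxx.
have [y gy] := Qtrunc_fin hw hQ Qd g0.
have lt1 : (Val 0 : withTop G) < t (1 - g * q).
  have : t F < t (F - g * q * F).
    have -> : F - g * q * F = (F - g * h) + g * (h - F * q) by ring.
    have gF : t F < t (g * (h - F * q)).
      by rewrite FE !tM [t g + t h]addrC [t g + _]addrC gy withTop_lt_add2r.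
    exact: Qtrunc_lt_add.
  have -> : F - g * q * F = (1 - g * q) * F by ring.
  by rewrite tM Fx -[X in X < _]add0r -[0 in X in X < _]/(Val 0) withTop_lt_add2r.
have one : t 1 = Val 0 /\ wp 1 = Val 0.
  have w1 : wp 1 = Val 0 by rewrite /on_poly rmorph1 valuation1.
  have := tM 1 1; rewrite mulr1.
  have [z ->] := Qtrunc_fin hw hQ Qd (oner_neq0 _).
  rewrite withTop_valD => -[/eqP].
  by rewrite -subr_eq0 opprD addNKr oppr_eq0 => /eqP ->.
have tgq : t (g * q) = Val 0.
  by rewrite -one.1; apply: Qtrunc_sub_lt; rewrite one.1.
have wgq : wp (g * q) = Val 0.
  rewrite -one.2; apply: (val_sub_lt hw); rewrite -rmorphB.
  by rewrite -[w _%:F]/(wp 1) one.2; apply: lt_le_trans lt1 (le _).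
have q0 : q != 0 by apply: contra_eq_neq tgq => ->; rewrite mulr0 Qtrunc0.
by have := Qtrunc_mul_lt ltg q0; rewrite tgq wgq ltxx.
Qed.

Lemma key_polynomialP F : ABKP wp F -> (size Q < size F)%N ->
  key_polynomial t F <->
  (forall f, (size f < size F)%N -> eps wp f <= eps wp Q).
Proof.
have [d Qd] := ABKP_eps hw hQ; move=> [Fm _ minF] sQF.
have ltF : t F < wp F.
  rewrite lt_neqAle (Qtrunc_le hw hQ Qd) andbT; apply/negP => /eqP.
  move/(Qtrunc_eq hw hQ Qd); apply/negP; rewrite -ltNge -Qd ltNge.
  by apply: contraL sQF => /minF; rewrite -leqNgt.
split=> [key f sf|h].
  rewrite Qd; apply/(Qtrunc_eq hw hQ Qd).
  exact: minimal_of_key_polynomial key ltF _ sf.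
apply: key_polynomial_of_minimal => // f sf.
by apply/(Qtrunc_eq hw hQ Qd); rewrite -Qd h.
Qed.

End KeyPolynomials.

(** * Embeddings of the algebraic closure *)
Section Conjugates.
Variables (K : fieldType) (Kbar : closedFieldType) (iota : {rmorphism K -> Kbar}).
Hypothesis hKbar : algebraic_closure iota.
Local Open Scope classical_set_scope.
Local Notation "p ^iota" := (map_poly iota p) (at level 2, format "p ^iota").

Lemma exists_irreducible x : exists2 P, irreducible_poly P & root P^iota x.
Proof.
have [p p0 px] := hKbar x.
pose S n := `[< exists q, [/\ q != 0, root q^iota x & size q = n] >].
have exS : exists n, S n by exists (size p); apply/asboolP; exists p.
case: (ex_minnP exS) => n /asboolP[P [P0 Px Pn]] nmin; exists P => //.
have minP q : q != 0 -> root q^iota x -> (size P <= size q)%N.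
  by move=> q0 qx; rewrite Pn nmin //; apply/asboolP; exists q.
split=> [|q q1 qP].
  rewrite ltnNge; apply/negP => /size1_polyC PE; move: Px P0; rewrite PE.
  by rewrite map_polyC rootC fmorph_eq0 polyC_eq0 => ->.
rewrite -dvdp_size_eqp // eqn_leq dvdp_leq //=.
have q0 : q != 0 by apply: contraTneq qP => ->; rewrite dvd0p.
have QE := divpK qP; set r := P %/ q in QE.
have r0 : r != 0 by apply: contraNneq P0 => r0; rewrite -QE r0 mul0r.
move: Px; rewrite -QE rmorphM rootM => /orP[rx|]; last by rewrite QE; apply: minP.
have := minP _ r0 rx; rewrite -{1}QE size_mul //.
have := q0; rewrite -size_poly_gt0; move: q1; case: (size q) => [|[|m]] // _ _.
by rewrite !addnS /= ltnNge leq_addr.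
Qed.

Lemma irreducible_dvdp P f x :
  irreducible_poly P -> root P^iota x -> root f^iota x -> P %| f.
Proof.
move=> [_ irr] Px fx; have [g1|g1] := eqVneq (size (gcdp P f)) 1%N.
  have : coprimep P^iota f^iota by rewrite coprimep_map /coprimep g1.
  by move/coprimep_root => /(_ _ Px); rewrite (negPf (_ : ~~ (_ != 0))) // negbK.
by rewrite -(eqp_dvdl _ (irr _ g1 (dvdp_gcdl P f))) dvdp_gcdr.
Qed.

(** R is the graph of a K-algebra morphism into Kbar, defined on some
    intermediate ring of Kbar over K.  With graphs, unions of chains and
    extensions need neither subfield types nor dependent domains. *)
Record partial_hom (R : set (Kbar * Kbar)) : Prop := PartialHom {
  phom_base : forall a, R (iota a, iota a);
  phom_sub : forall a a' b b', R (a, a') -> R (b, b') -> R (a - b, a' - b');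
  phom_mul : forall a a' b b', R (a, a') -> R (b, b') -> R (a * b, a' * b');
  phom_fun : forall z, R (0, z) -> z = 0
}.

Section PartialHom.
Variables (R : set (Kbar * Kbar)) (hR : partial_hom R).

Lemma phom_zero : R (0, 0).
Proof. by have := phom_base hR 0; rewrite rmorph0. Qed.

Lemma phom_add a a' b b' : R (a, a') -> R (b, b') -> R (a + b, a' + b').
Proof.
move=> aR bR; have := phom_sub hR phom_zero bR; rewrite !sub0r => /(phom_sub hR aR).
by rewrite !opprK.
Qed.

Lemma phom_exp a a' n : R (a, a') -> R (a ^+ n, a' ^+ n).
Proof.
move=> aR; elim: n => [|n IH]; last by rewrite !exprS; apply: (phom_mul hR).
by have := phom_base hR 1; rewrite rmorph1 !expr0.
Qed.

Lemma phom_sum (I : Type) (r : seq I) (P : pred I) (E E' : I -> Kbar) :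
  (forall i, P i -> R (E i, E' i)) ->
  R (\sum_(i <- r | P i) E i, \sum_(i <- r | P i) E' i).
Proof.
move=> h; elim: r => [|i r IH]; first by rewrite !big_nil; apply: phom_zero.
by rewrite !big_cons; case: ifP => // Pi; apply: phom_add => //; apply: h.
Qed.

Lemma phom_uniq a b c : R (a, b) -> R (a, c) -> b = c.
Proof.
move=> ab ac; have := phom_sub hR ab ac; rewrite subrr => /(phom_fun hR)/eqP.
by rewrite subr_eq0 => /eqP.
Qed.

(** Apply the morphism to the minimal equation of a: the image 0 of a would be a
    root of the minimal polynomial of a, which is therefore 'X. *)
Lemma phom_inj a : R (a, 0) -> a = 0.
Proof.
move=> aR; apply/eqP; apply: contraT => a0; have [P [P1 irr] Pa] := exists_irreducible a.
have P0 : P != 0 by rewrite -size_poly_gt0 (ltn_trans _ P1).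
have : R (P^iota.[a], P^iota.[0]).
  rewrite !horner_coef; apply: phom_sum => i _.
  by apply: (phom_mul hR); [rewrite coef_map; apply: phom_base | apply: phom_exp].
rewrite (rootP Pa) => /(phom_fun hR)/eqP root0.
have XP : 'X %| P.
  rewrite -['X]subr0 -[0](rmorph0 polyC) dvdp_XsubCl -(fmorph_root iota).
  by rewrite rmorph0.
have /(_ a) : root (map_poly iota 'X) =1 root P^iota.
  by apply: eqp_root; rewrite eqp_map irr ?size_polyX.
by rewrite Pa map_polyX rootX (negPf a0).
Qed.

(** The graph of the morphism induced by R on polynomials, coefficientwise. *)
Definition phom_poly (p p' : {poly Kbar}) := forall i, R (p`_i, p'`_i).

Lemma phom_poly_sub p p' q q' :
  phom_poly p p' -> phom_poly q q' -> phom_poly (p - q) (p' - q').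
Proof. by move=> hp hq i; rewrite !coefB; apply: (phom_sub hR). Qed.

Lemma phom_poly_mul p p' q q' :
  phom_poly p p' -> phom_poly q q' -> phom_poly (p * q) (p' * q').
Proof. by move=> hp hq i; rewrite !coefM; apply: phom_sum => j _; apply: (phom_mul hR). Qed.

Lemma phom_poly_C a a' : R (a, a') -> phom_poly a%:P a'%:P.
Proof. by move=> aR i; rewrite !coefC; case: ifP => // _; apply: phom_zero. Qed.

Lemma phom_poly_X n : phom_poly 'X^n 'X^n.
Proof.
move=> i; rewrite coefXn; case: (i == n); last exact: phom_zero.
by have := phom_base hR 1; rewrite rmorph1.
Qed.

Lemma phom_poly_map p : phom_poly p^iota p^iota.
Proof. by move=> i; rewrite coef_map; apply: phom_base. Qed.

Lemma phom_poly_size p p' : phom_poly p p' -> size p = size p'.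
Proof.
move=> pp; apply/eqP; rewrite eqn_leq; apply/andP; split; apply/leq_sizeP => i le.
  by apply: phom_inj; have := pp i; rewrite (nth_default 0 le).
by apply: (phom_fun hR); have := pp i; rewrite (nth_default 0 le).
Qed.

(** Take m of least degree among the polynomials over the domain of R that
    vanish at s, and let t be a root of the image m' of m.  Any p vanishing at s
    reduces to 0 modulo m, so its image vanishes at t, and p(s) |-> p'(t) is
    well defined. *)
Lemma phom_extend s : exists t R', [/\ partial_hom R', R `<=` R' & R' (s, t)].
Proof.
pose S n := `[< exists p p', [/\ phom_poly p p', p != 0, root p s & size p = n] >].
have exS : exists n, S n.
  have [P [P1 _] Ps] := exists_irreducible s.
  exists (size P); apply/asboolP; exists P^iota, P^iota; split=> //.
  - exact: phom_poly_map.
  - by rewrite map_poly_eq0 -size_poly_gt0 (ltn_trans _ P1).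
  - by rewrite size_map_poly.
case: (ex_minnP exS) => n /asboolP[m [m' [mm m0 ms mn]]] nmin.
have minm p p' : phom_poly p p' -> root p s -> (size p < size m)%N -> p = 0.
  move=> pp ps; rewrite mn ltnNge; apply: contraNeq => p0.
  by apply: nmin; apply/asboolP; exists p, p'.
have szm := phom_poly_size mm.
have [t tm] : exists t, root m' t.
  apply/closed_rootP; rewrite -szm; apply: contraNneq m0 => /eqP/size_poly1P[c c0 mE].
  by move: ms; rewrite mE rootC (negPf c0).
exists t; have key p p' : phom_poly p p' -> root p s -> root p' t.
  have [k] := ubnP (size p); elim: k p p' => // k IH p p' spk pp ps.
  have szp := phom_poly_size pp.
  have [sm|sm] := ltnP (size p) (size m).
    have p0 := minm _ _ pp ps sm.
    have -> : p' = 0 by apply/eqP; rewrite -size_poly_eq0 -szp p0 size_poly0.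
    exact: root0.
  have [p0|p0] := eqVneq p 0.
    have -> : p' = 0 by apply/eqP; rewrite -size_poly_eq0 -szp p0 size_poly0.
    exact: root0.
  (* Pseudo-division: q cancels the leading term of p without any inverse. *)
  pose e := (size p - size m)%N.
  pose q := (lead_coef m)%:P * p - (lead_coef p)%:P * ('X^e * m).
  pose q' := (lead_coef m')%:P * p' - (lead_coef p')%:P * ('X^e * m').
  have qq : phom_poly q q'.
    apply: phom_poly_sub; apply: phom_poly_mul => //.
    - by apply: phom_poly_C; rewrite !lead_coefE -szm; apply: mm.
    - by apply: phom_poly_C; rewrite !lead_coefE -szp; apply: pp.
    - by apply: phom_poly_mul => //; apply: phom_poly_X.
  have qs : root q s.
    by rewrite rootE hornerD hornerN !hornerM (rootP ps) (rootP ms) !mulr0 subrr.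
  have sq : (size q < size p)%N.
    have -> : size p = (size p).-1.+1 by rewrite prednK // size_poly_gt0.
    rewrite ltnS; apply/leq_sizeP => j; rewrite leq_eqVlt => /predU1P[<-|lt].
      rewrite coefB !coefCM coefXnM.
      have -> : ((size p).-1 < e)%N = false.
        apply/negbTE; rewrite -leqNgt /e -subn1 leq_sub2l //.
        by rewrite size_poly_gt0.
      have -> : ((size p).-1 - e = (size m).-1)%N.
        by rewrite /e -!subn1 -subnDA addnC subnDA subKn.
      by rewrite -!lead_coefE mulrC subrr.
    have pj : (size p <= j)%N by move: lt; case: (size p).
    rewrite coefB !coefCM coefXnM (nth_default _ pj) mulr0.
    case: ltnP => [_|ej]; first by rewrite mulr0 subr0.
    rewrite nth_default ?mulr0 ?subr0 //.
    by rewrite leq_subRL // /e subnK.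
  have := IH q q' (leq_trans sq (ltnSE spk)) qq qs.
  rewrite rootE hornerD hornerN !hornerM !hornerC (rootP tm) !mulr0 subr0.
  by rewrite mulf_eq0 lead_coef_eq0 -size_poly_eq0 -szm size_poly_eq0 (negPf m0).
exists [set z | exists p p', phom_poly p p' /\ z = (p.[s], p'.[t])]; split.
- split=> [a|a a' b b'|a a' b b'|z [p [p' [pp [p0 ->]]]]].
  + exists (iota a)%:P, (iota a)%:P; rewrite !hornerC; split=> //.
    by apply: phom_poly_C; apply: (phom_base hR).
  + move=> [p [p' [pp [-> ->]]]] [q [q' [qq [-> ->]]]].
    by exists (p - q), (p' - q'); rewrite !hornerE; split=> //; apply: phom_poly_sub.
  + move=> [p [p' [pp [-> ->]]]] [q [q' [qq [-> ->]]]].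
    by exists (p * q), (p' * q'); rewrite !hornerE; split=> //; apply: phom_poly_mul.
  + by apply/rootP; apply: key pp _; apply/rootP.
- by move=> [a a'] aR; exists a%:P, a'%:P; rewrite !hornerC; split=> //; apply: phom_poly_C.
- by exists 'X, 'X; rewrite !hornerX; split=> //; apply: (phom_poly_X 1).
Qed.

End PartialHom.

(** Zorn's lemma on the graphs containing (x, y); a maximal one is defined on the
    whole of Kbar by phom_extend. *)
Lemma exists_conjugation P x y :
  irreducible_poly P -> root P^iota x -> root P^iota y ->
  exists R, [/\ partial_hom R, R (x, y) & forall s, exists t, R (s, t)].
Proof.
move=> irrP Px Py.
pose good (R : set (Kbar * Kbar)) := partial_hom R /\ R (x, y).
pose R0 : set (Kbar * Kbar) := [set z | exists p, z = (p^iota.[x], p^iota.[y])].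
have good0 : good R0.
  split; last by exists 'X; rewrite map_polyX !hornerX.
  split=> [a|a a' b b' [p [-> ->]] [q [-> ->]]|a a' b b'|z [p [px ->]]].
  - by exists a%:P; rewrite map_polyC !hornerC.
  - by exists (p - q); rewrite rmorphB !hornerE.
  - by move=> [p [-> ->]] [q [-> ->]]; exists (p * q); rewrite rmorphM !hornerE.
  have {}px : root p^iota x by apply/rootP.
  apply/rootP; apply: root_dvdp Py.
  by rewrite dvdp_map (irreducible_dvdp irrP Px).
(* The empty set is admitted only to serve as the union of the empty chain. *)
have [|R [goodR maxR]] := @Zorn_bigcup _ [set R | R = set0 \/ good R].
  move=> C CP Ctot; have [[X [CX X0]]|noX] := pselect (exists X, C X /\ X <> set0); last first.
    left; rewrite -subset0 => z [X CX Xz]; apply: noX; exists X; split=> //.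
    by move=> X0; rewrite X0 in Xz.
  have goodX Y z : C Y -> Y z -> good Y.
    by move=> CY Yz; case: (CP Y CY) => // Y0; rewrite Y0 in Yz.
  have both z z' : (\bigcup_(Y in C) Y) z -> (\bigcup_(Y in C) Y) z' ->
      exists Y, [/\ C Y, good Y, Y z & Y z'].
    move=> [Y CY Yz] [Y' CY' Yz']; case: (Ctot _ _ CY CY') => sub.
      by exists Y'; split=> //; [apply: goodX Yz' | apply: sub].
    by exists Y; split=> //; [apply: goodX Yz | apply: sub].
  have [hX Xxy] : good X by case: (CP X CX).
  right; split; last by exists X.
  split=> [a|a a' b b' ha hb|a a' b b' ha hb|z hz].
  - by exists X => //; apply: phom_base.
  - have [Y [CY [hY _] Ya Yb]] := both _ _ ha hb.
    by exists Y => //; apply: (phom_sub hY).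
  - have [Y [CY [hY _] Ya Yb]] := both _ _ ha hb.
    by exists Y => //; apply: (phom_mul hY).
  - by have [Y [CY [hY _] Yz _]] := both _ _ hz hz; apply: (phom_fun hY).
have {goodR} [hR Rxy] : good R.
  case: goodR => // RE; exfalso; apply: (maxR R0); last by right.
  rewrite RE; split=> // /(_ (x, y)); apply.
  by exists 'X; rewrite map_polyX !hornerX.
exists R; split=> // s; have [t [R' [hR' RR' st]]] := phom_extend hR s.
exists t; apply: contrapT => nst; apply: (maxR R'); last by right; split=> //; apply: RR'.
by split=> // R'R; apply/nst/R'R.
Qed.

End Conjugates.

(** * Degrees of algebraic elements *)
Section Degree.
Variables (K : fieldType) (Kbar : closedFieldType) (iota : {rmorphism K -> Kbar}).
Local Notation "p ^iota" := (map_poly iota p) (at level 2, format "p ^iota").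

(** Invariance of dimension, through mutually inverse change of basis matrices. *)
Lemma has_dim_le (S : set Kbar) n m : has_dim iota S n -> has_dim iota S m -> (n <= m)%N.
Proof.
move=> [e [eS ebasis]] [e' [eS' ebasis']].
have /choice [A AE] : forall i, exists c : 'rV_m, e i = \sum_j iota (c 0 j) * e' j.
  by move=> i; have [c [cE _]] := ebasis' _ (eS i); exists c.
have /choice [B BE] : forall i, exists c : 'rV_n, e' i = \sum_j iota (c 0 j) * e j.
  by move=> i; have [c [cE _]] := ebasis _ (eS' i); exists c.
suff : (\matrix_(i, j) A i 0 j) *m (\matrix_(i, j) B i 0 j) = 1%:M by apply: mulmx1_min.
apply/row_matrixP => i; have [c [_ cuniq]] := ebasis _ (eS i).
rewrite -[RHS]cuniq; last first.
  rewrite (bigD1 i) //= !mxE eqxx rmorph1 mul1r big1 ?addr0 // => j ji.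
  by rewrite !mxE eq_sym (negPf ji) rmorph0 mul0r.
apply/esym/cuniq; rewrite {1}AE; under eq_bigr => j _ do rewrite BE mulr_sumr.
rewrite exchange_big; apply: eq_bigr => k _ /=; rewrite !mxE rmorph_sum mulr_suml.
by apply: eq_bigr => j _; rewrite !mxE rmorphM mulrA.
Qed.

(** The powers t^0, ..., t^(n-1) with n = deg P: a denominator q with q(t) != 0 is
    coprime to P, so Bezout's identity inverts q(t) polynomially, and reduction
    modulo P bounds the degree. *)
Lemma has_dim_adjoin P t : irreducible_poly P -> root P^iota t ->
  has_dim iota (adjoin iota t) (size P).-1.
Proof.
move=> irrP Pt; have [P1 irr] := irrP; set n := (size P).-1.
have P0 : P != 0 by rewrite -size_poly_gt0 (ltn_trans _ P1).
have nP : (n < size P)%N by rewrite /n prednK // size_poly_gt0.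
have evalE (c : 'rV[K]_n) : (rVpoly c)^iota.[t] = \sum_i iota (c 0 i) * t ^+ i.
  rewrite (@horner_coef_wide _ n); last by rewrite size_map_poly size_poly.
  by apply: eq_bigr => i _; rewrite coef_map coef_rVpoly_ord.
exists (fun i => t ^+ i); split=> [i|x [p [q [qt ->]]]].
  exists 'X^i, 1; rewrite rmorph1 hornerC oner_neq0 divr1.
  by rewrite map_polyXn hornerXn.
have cop : coprimep P q.
  rewrite /coprimep; apply: contraNT qt => g1; apply/eqP/rootP.
  apply: (root_dvdp _ Pt); rewrite dvdp_map.
  by rewrite -(eqp_dvdl _ (irr _ g1 (dvdp_gcdl P q))) dvdp_gcdr.
have /Bezout_eq1_coprimepP[[a b] /= abE] := cop.
have qinv : b^iota.[t] * q^iota.[t] = 1.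
  have := congr1 (fun g => g^iota.[t]) abE.
  by rewrite /= rmorphD !rmorphM rmorph1 hornerD !hornerM (rootP Pt) mulr0 add0r hornerC.
set r := (p * b) %% P.
have xE : p^iota.[t] / q^iota.[t] = r^iota.[t].
  have -> : (q^iota.[t])^-1 = b^iota.[t] by rewrite -[LHS]mul1r -qinv mulfK.
  have pbE : p * b = (p * b) %/ P * P + r := divp_eq (p * b) P.
  rewrite -hornerM -rmorphM pbE rmorphD rmorphM /= hornerD hornerM.
  by rewrite (rootP Pt) mulr0 add0r.
have rn : (size r <= n)%N by rewrite -ltnS prednK ?ltn_modpN0 // size_poly_gt0.
exists (poly_rV r); split=> [|c]; first by rewrite xE -evalE poly_rV_K.
rewrite xE -evalE => cE; apply: (can_inj rVpolyK); rewrite poly_rV_K //.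
apply/eqP; rewrite -subr_eq0; apply: contraT => d0.
have dt : root (r - rVpoly c)^iota t by rewrite rootE rmorphB hornerD hornerN cE subrr.
have := dvdp_leq d0 (irreducible_dvdp irrP Pt dt).
rewrite leqNgt (leq_ltn_trans _ nP) // (leq_trans (size_polyD _ _)) //.
by rewrite size_polyN geq_max rn size_poly.
Qed.

Lemma degree_root P t : irreducible_poly P -> root P^iota t ->
  degree iota t = (size P).-1.
Proof.
move=> irrP Pt; have dimP := has_dim_adjoin irrP Pt.
apply: xget_unique => // m dimm.
by apply/eqP; rewrite eqn_leq !(has_dim_le (S := adjoin iota t)).
Qed.

End Degree.

(** * Slopes and roots *)
Section PolynomialRoots.
Variables (G : ordQSpace) (L : fieldType) (u : L -> withTop G) (hu : valuation u).

Lemma gauss_lead_linear (d e : G) y : u y = Val e -> e <= d ->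
  gauss_lead u d ('X + y%:P) e (e == d).
Proof.
move=> ye ed; have g0 : gauss_term u d ('X + y%:P) 0 = Val e.
  by rewrite /gauss_term coefD coefX coefC /= add0r ye addr0.
have g1 : gauss_term u d ('X + y%:P) 1 = Val d.
  by rewrite /gauss_term coefD coefX coefC /= addr0 valuation1 // withTop_valD add0r.
have g2 i : (1 < i)%N -> gauss_term u d ('X + y%:P) i = Infty.
  by case: i => [|[|i]] // _; rewrite /gauss_term coefD coefX coefC addr0 valuation0.
split.
- by case=> [|[|i]]; rewrite ?g0 ?g1 ?lexx // g2 ?lex1.
- by case: (eqVneq e d) => [->|_]; rewrite ?g0 ?g1.
- move=> i; case: (eqVneq e d) => [_ /g2->|ne] //.
  case: i => [|[|i]] // _; last by rewrite g2.
  by rewrite g1 -[_ < _]/(e < d) lt_neqAle ne.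
Qed.

Lemma gauss_lead_const (d e : G) y : u y = Val e -> gauss_lead u d y%:P e 0.
Proof.
move=> ye; have g0 : gauss_term u d y%:P 0 = Val e by rewrite /gauss_term coefC ye addr0.
have g1 i : (0 < i)%N -> gauss_term u d y%:P i = Infty.
  by case: i => // i _; rewrite /gauss_term coefC valuation0.
split=> [[|i]||i i0]; rewrite ?g0 ?lexx //; first by rewrite g1 ?lex1.
by rewrite g1.
Qed.

(** Each factor X - z becomes Y + (t - z), whose leading index is 1 if t - z has
    value d and 0 if it has smaller value; conclude by Gauss's lemma. *)
Lemma gauss_lead_roots (d : G) (c t : L) (rs : seq L) :
  c != 0 -> (forall z, z \in rs -> u (t - z) <= Val d) ->
  let g := c *: \prod_(z <- rs) ('X - z%:P) in
  exists2 e, u g.[t] = Val e &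
    gauss_lead u d (taylor t g) e (count (fun z => u (t - z) == Val d) rs).
Proof.
move=> c0 h g; have [b cb] := val_fin hu c0; rewrite {}/g.
have lin z : taylor t ('X - z%:P) = 'X + (t - z)%:P.
  by rewrite /taylor rmorphB /= comp_polyX comp_polyC polyCB addrA.
rewrite -mul_polyC; elim: rs h => [|z rs IH] h.
  rewrite big_nil mulr1 hornerC; exists b => //.
  by rewrite /taylor comp_polyC; apply: gauss_lead_const.
have [|e ge ne] := IH; first by move=> y ys; apply: h; rewrite inE ys orbT.
have zd : u (t - z) <= Val d by apply: h; rewrite mem_head.
have [k zk] : exists k, u (t - z) = Val k.
  by case: (u (t - z)) zd => // k _; exists k.
exists (k + e).
  rewrite big_cons mulrCA hornerM (val_mul hu) ge -withTop_valD -zk.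
  by rewrite hornerD hornerN hornerX hornerC.
rewrite big_cons mulrCA /taylor rmorphM /= -!/(taylor _ _) lin.
apply: gauss_lead_mul => //.
have := gauss_lead_linear zk (_ : k <= d); rewrite zk; apply.
by move: zd; rewrite zk.
Qed.

(** Otherwise in 0 = g(z) = sum_b (d_b g)(t) (z - t)^b the term of index 0 would
    have strictly the smallest value. *)
Lemma root_not_steep (d : G) (g : {poly L}) t z : root g z -> g.[t] != 0 ->
  u (t - z) = Val d -> ~ forall b, (0 < b)%N -> u g.[t] < gauss_term u d (taylor t g) b.
Proof.
move=> gz gt tz steep; have [c gc] := val_fin hu gt.
have n0 : (0 < size g)%N by rewrite size_poly_gt0; apply: contraNneq gt => ->; rewrite horner0.
have : u g.[z] = Val c.
  rewrite -(subrKC t z) nderiv_taylor; last exact: mulrC.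
  apply: (val_sum_dominant hu (j := Ordinal n0)) => [|i].
    by rewrite /= nderivn0 expr0 mulr1.
  rewrite -val_eqE -lt0n => /= i0; rewrite (val_mul hu) valuationX //.
  rewrite -opprB valuationN // tz withTop_valMn.
  by have := steep i i0; rewrite gc /gauss_term coef_taylor.
by rewrite (rootP gz) valuation0.
Qed.

End PolynomialRoots.

(** * Henselian base field *)
Section Henselian.
Variables (G : ordQSpace) (K : fieldType) (v : K -> withTop G).
Variables (Kbar : closedFieldType) (iota : {rmorphism K -> Kbar}).
Hypothesis hKbar : algebraic_closure iota.
Hypothesis hens : henselian iota v.
Variables (vbar : Kbar -> withTop G) (hvbar : valuation vbar).
Hypothesis vbar_ext : extends iota v vbar.
Variables (w : {fraction {poly K}} -> withTop G) (hw : valuation w).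
Hypothesis w_ext : extends (fun a : K => (a%:P)%:F) v w.
Local Notation wp := (on_poly w).
Local Notation "p ^iota" := (map_poly iota p) (at level 2, format "p ^iota").

(** Composing vbar with a K-embedding of Kbar sending x to y yields another
    extension of v, equal to vbar since K is henselian. *)
Lemma vbar_conj P x y : irreducible_poly P -> root P^iota x -> root P^iota y ->
  vbar x = vbar y.
Proof.
move=> irrP Px Py; have [R [hR Rxy tot]] := exists_conjugation hKbar irrP Px Py.
have [s sR] := choice tot.
have phomE a b : R (a, b) -> s a = b by move=> ab; apply: (phom_uniq hR) (sR a) ab.
have s_eq0 a : s a = 0 <-> a = 0.
  split=> [a0|->]; last by apply: phomE; apply: phom_zero hR.
  by apply: (phom_inj hKbar hR); rewrite -a0.
have sval : valuation (fun a => vbar (s a)).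
  split=> [a|a b|a b].
  - by rewrite (val_eqoo hvbar) s_eq0.
  - by rewrite -(val_mul hvbar); congr vbar; apply/phomE/(phom_mul hR).
  - have -> : s (a + b) = s a + s b by apply/phomE/(phom_add hR).
    exact: (val_add hvbar).
have sext : extends iota v (fun a => vbar (s a)).
  by move=> a; rewrite (phomE _ _ (phom_base hR a)) vbar_ext.
by rewrite -(hens sval sext hvbar vbar_ext) (phomE _ _ Rxy).
Qed.

(** All roots of P are conjugate to x, so the Newton polygon of P is a segment of
    slope c: both end terms, of index 0 and deg P, attain the Gauss value e. *)
Lemma gauss_lead_minpoly P x (c : G) :
  irreducible_poly P -> root P^iota x -> vbar x = Val c ->
  exists e, gauss_lead vbar c P^iota e (size P).-1 /\ vbar (P^iota)`_0 = Val e.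
Proof.
move=> irrP Px xc; have P0 : P^iota != 0.
  by case: irrP => P1 _; rewrite map_poly_eq0 -size_poly_gt0 (ltn_trans _ P1).
have [rs PE] := closed_field_poly_normal P^iota.
have lc0 : lead_coef P^iota != 0 by rewrite lead_coef_eq0.
have rsc z : z \in rs -> vbar (0 - z) = Val c.
  move=> zrs; rewrite sub0r valuationN // -xc; apply: vbar_conj irrP _ Px.
  by rewrite PE rootZ // root_prod_XsubC.
have [|e /= Pe nP] := gauss_lead_roots hvbar (d := c) (t := 0) (rs := rs) lc0.
  by move=> z /rsc ->.
have szP : (size P).-1 = size rs.
  rewrite -(size_map_poly iota) PE size_scale // size_prod_XsubC //.
exists e; rewrite szP -PE in Pe nP *; rewrite -horner_coef0; split=> //.
rewrite /taylor addr0 comp_polyXr in nP.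
suff /eqP E : count (fun z => vbar (0 - z) == Val c) rs == size rs by rewrite E in nP.
by rewrite -all_count; apply/allP => z /rsc ->.
Qed.

Section Residue.
Variables (F : {poly K}) (hF : ABKP wp F) (theta : Kbar) (Ftheta : root F^iota theta).
Implicit Types (f : {poly K}) (d : G).

Lemma horner_neq0 f :
  f != 0 -> (size f < size F)%N -> f^iota.[theta] != 0.
Proof.
move=> f0 sfF; apply: contraTN sfF => ftheta; rewrite -leqNgt.
by apply: dvdp_leq f0 (irreducible_dvdp (ABKP_irreducible hw hF) Ftheta ftheta).
Qed.

Lemma on_poly_pow_rem f n :
  (size f < size F)%N -> wp (f ^+ n %% F) = wp f *+ n.
Proof.
move=> sf; have [Fm F1 _] := hF; have F0 := monic_neq0 Fm.
elim: n => [|n IH].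
  by rewrite modp_small ?size_poly1 // /on_poly rmorph1 valuation1.
rewrite exprS -modp_mul (ABKP_mul_rem hw hF) ?ltn_modpN0 //.
by rewrite (on_polyM hw) IH mulrS.
Qed.

(** Let P = sum_j p_j X^j be the minimal polynomial of f(theta).  The
    polynomials p_j (f^j mod F) sum up to 0, and they have values
    v(p_j) + j w(f).  If w(f) differed from c = vbar(f(theta)), then, the Newton
    polygon of P being a segment of slope c, a single one of these values, that
    of index deg P or 0, would be the smallest. *)
Lemma on_poly_horner f :
  (size f < size F)%N -> wp f = vbar f^iota.[theta].
Proof.
move=> sf; have [Fm F1 _] := hF; have F0 := monic_neq0 Fm.
have [->|f0] := eqVneq f 0; first by rewrite rmorph0 horner0 valuation0 // on_poly0.
have [c fc] := val_fin hvbar (horner_neq0 f0 sf).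
have [a fa] := on_poly_fin hw f0.
have [P irrP Pf] := exists_irreducible hKbar f^iota.[theta].
have [e [[ge ee _] e0]] := gauss_lead_minpoly irrP Pf fc.
have P1 : (1 < size P)%N by case: irrP.
pose E (j : 'I_(size P)) : {poly K} := P`_j *: (f ^+ j %% F).
have E0 : \sum_j (E j)%:F = 0.
  suff -> : \sum_j (E j)%:F = ((P \Po f) %% F)%:F.
    have -> : (P \Po f) %% F = 0; last exact: rmorph0.
    apply/eqP; apply: irreducible_dvdp (ABKP_irreducible hw hF) Ftheta _.
    by rewrite map_comp_poly rootE horner_comp.
  rewrite -rmorph_sum comp_polyE; congr _%:F.
  by rewrite (big_morph _ (modpD F) (mod0p F)); apply: eq_bigr => j _; rewrite modpZl.
have EE j : w (E j)%:F = vbar (P^iota)`_j + Val (a *+ j).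
  rewrite /E -mul_polyC rmorphM (val_mul hw) w_ext coef_map /= vbar_ext.
  by rewrite -[w _ in LHS]/(wp _) on_poly_pow_rem // fa withTop_valMn.
have dom (j0 : 'I_(size P)) (z : G) : w (E j0)%:F = Val z ->
    (forall j, j != j0 -> Val z < w (E j)%:F) -> False.
  move=> Ez lt; have := val_sum_dominant hw (E := fun j => (E j)%:F) Ez lt.
  by rewrite E0 valuation0.
rewrite fa fc; case: (ltgtP a c) => [ac|ca|->] //; exfalso.
  have nP : ((size P).-1 < size P)%N by rewrite prednK // ltnW.
  have [k kE] : exists k, vbar (P^iota)`_(size P).-1 = Val k.
    by move: ee; rewrite /gauss_term; case: (vbar _) => // k _; exists k.
  apply: (dom (Ordinal nP)); first by rewrite EE /= kE withTop_valD.
  move=> j; rewrite -val_eqE /= => jn; have {}jn : (j < (size P).-1)%N.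
    by rewrite ltn_neqAle jn -ltnS (ltn_predK P1) ltn_ord.
  rewrite EE; have := ge j; rewrite /gauss_term; case: (vbar _) => // y.
  move: ee; rewrite /gauss_term kE withTop_valD => -[<-].
  rewrite -(subnKC (ltnW jn)) addnC !mulrnDr !addrA.
  rewrite -(withTop_valD _ (c *+ j)) -(withTop_valD _ (a *+ j))
    withTop_le_add2r withTop_lt_add2r.
  apply: lt_le_trans; rewrite -[_ < _]/(k + _ < k + _) ![k + _]addrC ltG_add2r.
  by rewrite ltG_mulrn2r // subn_gt0.
apply: (dom (Ordinal (ltnW P1))); first by rewrite EE /= e0 addr0.
move=> j; rewrite -val_eqE -lt0n => /= j0; rewrite EE.
have := ge j; rewrite /gauss_term; case: (vbar _) => // y le_e; apply: le_lt_trans le_e _.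
rewrite -[_ < _]/(y + _ < y + _) ![y + _]addrC ltG_add2r.
by rewrite ltG_mulrn2r.
Qed.

(** All Hasse derivatives of f also have degree < deg F, so their w-values are
    values at theta: the expansions of f at theta and at the generic point have
    the same Newton polygon. *)
Lemma gauss_term_taylor d f b : (size f < size F)%N ->
  gauss_term vbar d (taylor theta f^iota) b = wp f^`N(b) + Val (d *+ b).
Proof.
move=> sf; rewrite /gauss_term coef_taylor nderivn_map on_poly_horner //.
exact: leq_ltn_trans (size_nderivn_le f b) sf.
Qed.

Lemma gauss_lead_small_roots d f : f != 0 -> (size f < size F)%N ->
  (forall b, root f^iota b -> vbar (theta - b) <= Val d) ->
  exists rs e, [/\ wp f = Val e, all (root f^iota) rs &
    gauss_lead vbar d (taylor theta f^iota) e
      (count (fun z => vbar (theta - z) == Val d) rs)].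
Proof.
move=> f0 sf le; have [rs fE] := closed_field_poly_normal f^iota.
have lc0 : lead_coef f^iota != 0 by rewrite lead_coef_eq0 map_poly_eq0.
have rsf : all (root f^iota) rs.
  by apply/allP => z zrs; rewrite fE rootZ // root_prod_XsubC.
have [|e /= fe nf] := gauss_lead_roots hvbar (d := d) (t := theta) (rs := rs) lc0.
  by move=> z /(allP rsf)/le.
by rewrite -fE in fe nf; exists rs, e; rewrite on_poly_horner.
Qed.

Lemma eps_le_roots d f : (size f < size F)%N ->
  (forall b, root f^iota b -> vbar (theta - b) <= Val d) -> eps wp f <= BVal d.
Proof.
move=> sf le; have [->|f0] := eqVneq f 0; first by rewrite eps_top // on_poly0.
have [rs [e [fe _ [ge _ _]]]] := gauss_lead_small_roots f0 sf le.
by apply/(eps_le (on_poly0 hw) d fe) => b _; rewrite -gauss_term_taylor.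
Qed.

Lemma eps_lt_roots d f : (size f < size F)%N ->
  (forall b, root f^iota b -> vbar (theta - b) < Val d) -> eps wp f < BVal d.
Proof.
move=> sf lt; have [->|f0] := eqVneq f 0; first by rewrite eps_top // on_poly0.
have [rs [e [fe rsf]]] := gauss_lead_small_roots f0 sf (fun b fb => ltW (lt b fb)).
have -> : count (fun z => vbar (theta - z) == Val d) rs = 0%N.
  rewrite (eq_in_count (a2 := pred0)) ?count_pred0 // => z /(allP rsf)/lt ltz.
  by apply/negbTE; rewrite neq_lt ltz.
case=> _ _ gt; apply/(eps_lt (on_poly0 hw) d fe) => b b0.
by rewrite -gauss_term_taylor // gt.
Qed.

Lemma root_lt_eps d f b : f != 0 -> (size f < size F)%N -> eps wp f < BVal d ->
  root f^iota b -> vbar (theta - b) < Val d.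
Proof.
move=> f0 sf ltd fb; rewrite ltNge; apply/negP => le.
have ftheta := horner_neq0 f0 sf.
have tb : theta - b != 0.
  by apply: contraNneq ftheta => /eqP; rewrite subr_eq0 => /eqP ->; apply/eqP/rootP.
have [e be] := val_fin hvbar tb; apply: (root_not_steep hvbar fb ftheta be) => j j0.
have [x fx] := on_poly_fin hw f0; rewrite -on_poly_horner // fx gauss_term_taylor //.
apply: lt_le_trans ((eps_lt (on_poly0 hw) d fx).1 ltd j j0) _.
rewrite withTop_leD // -[_ <= _]/(_ <= _ :> G); apply: leG_mulrn2r.
by move: le; rewrite be.
Qed.

Lemma root_le_eps d f b : f != 0 -> (size f < size F)%N -> eps wp f <= BVal d ->
  root f^iota b -> vbar (theta - b) <= Val d.
Proof.
move=> f0 sf led fb; rewrite leNgt; apply/negP => lt.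
have ftheta := horner_neq0 f0 sf.
have tb : theta - b != 0.
  by apply: contraNneq ftheta => /eqP; rewrite subr_eq0 => /eqP ->; apply/eqP/rootP.
have [e be] := val_fin hvbar tb; rewrite be in lt.
have epse : eps wp f < BVal e by apply: le_lt_trans led _.
have := root_lt_eps f0 sf epse fb.
by rewrite be ltxx.
Qed.

End Residue.

Lemma degree_lt_size f b : f != 0 -> root f^iota b -> (degree iota b < size f)%N.
Proof.
move=> f0 fb; have [P irrP Pb] := exists_irreducible hKbar b.
rewrite (degree_root irrP Pb) (leq_trans _ (dvdp_leq f0 (irreducible_dvdp irrP Pb fb))) //.
by case: irrP => P1 _; rewrite ltn_predL (ltn_trans _ P1).
Qed.

Lemma exists_degree b : exists P : {poly K},
  [/\ P != 0, root P^iota b & (size P = (degree iota b).+1)%N].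
Proof.
have [P irrP Pb] := exists_irreducible hKbar b; exists P.
have [P1 _] := irrP; rewrite (degree_root irrP Pb) (ltn_predK P1).
by rewrite -size_poly_gt0 (ltn_trans _ P1).
Qed.

(** By the previous lemmas, eps f is the largest vbar(theta - b) for b a root of
    f, as long as deg f < deg F. *)
Lemma distinguished_eps Q F : ABKP wp Q -> ABKP wp F ->
  distinguished_poly iota vbar F Q <->
  (size Q < size F)%N /\ forall f : {poly K}, (size f < size F)%N -> eps wp f <= eps wp Q.
Proof.
move=> hQ hF; have irrQ := ABKP_irreducible hw hQ; have irrF := ABKP_irreducible hw hF.
have [Q1 _] := irrQ; have [F1 _] := irrF; have [_ _ minQ] := hQ.
have Q0 : Q != 0 by rewrite -size_poly_gt0 ltnW.
split=> [[_ _ [theta [a [Ftheta Qa [lt_deg [_ max_a] _]]]]]|[sQF epsQ]].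
  have sQF : (size Q < size F)%N.
    move: lt_deg; rewrite (degree_root irrQ Qa) (degree_root irrF Ftheta).
    by rewrite -ltnS (ltn_predK Q1) (ltn_predK F1).
  split=> // f sf.
  have ta : theta - a != 0.
    by apply: contraTneq lt_deg => /eqP; rewrite subr_eq0 => /eqP ->; rewrite ltnn.
  have [d ad] := val_fin hvbar ta.
  apply: (@le_trans _ _ (BVal d)).
    have [->|f0] := eqVneq f 0; first by rewrite eps_top // on_poly0.
    apply: (eps_le_roots hF Ftheta) => // b fb; rewrite -ad; apply: max_a.
    exists b => //=; rewrite (degree_root irrF Ftheta) -ltnS (ltn_predK F1).
    exact: leq_ltn_trans (degree_lt_size f0 fb) sf.
  rewrite leNgt; apply/negP => /(root_lt_eps hF Ftheta Q0 sQF) /(_ Qa).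
  by rewrite ad ltxx.
have [theta Ftheta] : exists theta, root F^iota theta.
  by apply/closed_rootP; rewrite size_map_poly neq_ltn F1 orbT.
have [d Qd] := ABKP_eps hw hQ.
have [a Qa ad] : exists2 a, root Q^iota a & Val d <= vbar (theta - a).
  apply: contrapT => noroot; have : eps wp Q < BVal d.
    apply: (eps_lt_roots hF Ftheta) => // a Qa; rewrite ltNge; apply/negP => da.
    by apply: noroot; exists a.
  by rewrite Qd ltxx.
have {}ad : vbar (theta - a) = Val d.
  by apply/le_anti; rewrite ad andbT (root_le_eps hF Ftheta Q0 sQF) // Qd.
have degQ := degree_root irrQ Qa; have degF := degree_root irrF Ftheta.
have lt_deg : (degree iota a < degree iota theta)%N.
  by rewrite degQ degF -ltnS (ltn_predK Q1) (ltn_predK F1).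
split=> //; exists theta, a; split=> //; split=> //.
- split; first by exists a.
  move=> _ [b /= lt_b <-]; have [P [P0 Pb sP]] := exists_degree b.
  have sPF : (size P < size F)%N by rewrite sP -(ltn_predK F1) ltnS -degF.
  by rewrite ad; apply: (root_le_eps hF Ftheta P0 sPF) Pb; rewrite -Qd epsQ.
- move=> c lt_c; have [P [P0 Pc sP]] := exists_degree c.
  have sPQ : (size P < size Q)%N by rewrite sP -(ltn_predK Q1) ltnS -degQ.
  rewrite ad; apply: (root_lt_eps hF Ftheta P0 (ltn_trans sPQ sQF)) Pc.
  by rewrite -Qd ltNge; apply: contraL sPQ => /minQ; rewrite -leqNgt.
Qed.

End Henselian.

Theorem corollary1p17
  (G : ordQSpace) (K : fieldType)
  (v : K -> withTop G) (hv : valuation v)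
  (Kbar : closedFieldType) (iota : {rmorphism K -> Kbar})
  (hKbar : algebraic_closure iota)
  (hens : henselian iota v)
  (vbar : Kbar -> withTop G) (hvbar : valuation vbar)
  (vbar_ext : extends iota v vbar)
  (w : {fraction {poly K}} -> withTop G) (hw : valuation w)
  (w_ext : extends (fun a : K => (a%:P)%:F) v w)
  (Q : {poly K}) (hQ : ABKP (on_poly w) Q)
  (F : {poly K}) (hF : ABKP (on_poly w) F) :
  distinguished_poly iota vbar F Q
  <-> (key_polynomial (trunc (on_poly w) Q) F /\ (size Q < size F)%N).
Proof.
rewrite (distinguished_eps hKbar hens hvbar vbar_ext hw w_ext hQ hF).
by split=> -[h1 h2]; split=> //; apply/(key_polynomialP hw hQ hF).
Qed.
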